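(* Let $p=p(n)\in[0,1]$, let $G=G(Q^n,p)$ be a random subgraph of the $n$-cube, let $\Delta=\Delta(G)$ be the maximum degree of $G$, and let $\lambda_1(G)$ be the largest eigenvalue of the adjacency matrix of $G$. Then almost surely (as $n\to\infty$) $$\lambda_1(G)=\big(1+o(1)\big)\max\big(\sqrt{\Delta},\,np\big),$$ where the $o(1)$ term tends to zero as $\max(\sqrt{\Delta(G)},np)$ tends to infinity. Precisely: there is a function $\delta:[0,\infty)\to[0,\infty)$ with $\delta(x)\to 0$ as $x\to\infty$ such that, for every sequence $p=p(n)\in[0,1]$, writing $M=\max(\sqrt{\Delta(G)},np)$, $$\Pr\big(\,|\lambda_1(G)-M|\le \delta(M)\,M\,\big)\to 1\quad\text{as } n\to\infty .$$
   Context: The $n$-cube $Q^n$ is the graph with vertex set $\{0,1\}^n$ in which two vectors are adjacent if and only if they differ in exactly one coordinate. The random subgraph $G(Q^n,p)$ has vertex set $\{0,1\}^n$, and each edge of $Q^n$ is included independently with probability $p=p(n)$. An event depending on $n$ holds almost surely if its probability tends to $1$ as $n\to\infty$. The adjacency matrix of $G$ is the $2^n\times 2^n$ real symmetric $0/1$ matrix indexed by the vertices, with $(x,y)$ entry equal to $1$ if and only if $xy$ is an edge of $G$. *)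

(* Defs.v *)
From HB Require Import structures.
From mathcomp Require Import all_boot all_order all_algebra.
From mathcomp Require Import all_classical all_reals all_analysis.

Set Implicit Arguments.
Unset Strict Implicit.
Unset Printing Implicit Defensive.

Import Order.TTheory GRing.Theory Num.Theory.
Import numFieldNormedType.Exports.

Local Open Scope ring_scope.

Definition cube (n : nat) : finType := {ffun 'I_n -> bool}.

Definition cube_adj (n : nat) (x y : cube n) : bool :=
  #|[set i | x i != y i]%SET| == 1%N.

(* Graphs on [V] are given by their edge sets, an edge being an unordered pair
   [set x; y] of vertices. *)
Definition cube_edges (n : nat) : {set {set cube n}} :=
  [set e : {set cube n} |
    [exists x, exists y, cube_adj x y && (e == [set x; y]%SET)]]%SET.

Definition adjacent (V : finType) (E : {set {set V}}) (x y : V) : bool :=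
  [set x; y]%SET \in E.

Definition degree (V : finType) (E : {set {set V}}) (x : V) : nat :=
  #|[set y | adjacent E x y]%SET|.

Definition max_degree (V : finType) (E : {set {set V}}) : nat :=
  \max_(x : V) degree E x.

Definition adj_mx (R : realType) (V : finType) (E : {set {set V}}) :
    'M[R]_#|V| :=
  \matrix_(i, j) (adjacent E (enum_val i) (enum_val j))%:R.

(* The eigenvalues of a real symmetric matrix of positive size form a finite
   nonempty set of reals, so that this supremum is then a maximum. *)
Definition largest_eigenvalue (R : realType) (m : nat) (A : 'M[R]_m) : R :=
  sup [set a : R | eigenvalue A a]%classic.

Definition lambda1 (R : realType) (V : finType) (E : {set {set V}}) : R :=
  largest_eigenvalue (adj_mx R E).

(* The probability that the edge set of $G(Q^n,p)$ satisfies [P]: the sample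
   space is the set of spanning subgraphs of the cube with the product law. *)
Definition prob_cube (R : realType) (n : nat) (p : R)
    (P : pred {set {set cube n}}) : R :=
  \sum_(E in powerset (cube_edges n) | P E)
    \prod_(e in cube_edges n) (if e \in E then p else 1 - p).

(* Main.v *)
(* Lower bound: a star gives [lambda1 >= sqrt Delta], the constant vector gives
   [lambda1 >= 2|E|/2^n], and [|E|] is concentrated.
   Upper bound: fix a threshold [t], slightly above [np] when [p] is not too
   small. Vertices of one parity class have independent degrees, so with high
   probability the degrees above [t] within distance two of any given vertex
   have a small sum [X]. Split the adjacency matrix into the part [D] between low
   vertices (norm at most [t]), the part [S] between low and very high vertices,
   and the rest. Since two vertices of the cube have at most two common
   neighbours, counting 2-walks gives [|S|^2 <= Delta + O(X/s)], where [s] is the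
   degree bound for very high vertices, and shows that the rest is negligible and
   that [S D] is small. Nearly orthogonal operators do not add up, hence
   [|S + D|] is close to [max(|S|, |D|)]. All failure probabilities are bounded
   by functions of [n] alone, and all relative errors by negative powers of [n]
   or of the maximum [M], hence by a negative power of [M <= n]. *)
From HB Require Import structures.
From mathcomp Require Import all_boot all_order all_algebra.
From mathcomp Require Import all_classical all_reals all_analysis.
From mathcomp Require Import ring lra zify.
Require Import Defs.

Set Implicit Arguments.
Unset Strict Implicit.
Unset Printing Implicit Defensive.

Import Order.TTheory GRing.Theory Num.Theory.
Import numFieldNormedType.Exports.

Local Open Scope ring_scope.

(** * Nonnegative kernels and operator norms *)

Section Kernels.
Variables (R : realType) (V : finType).
Implicit Types (x y : V -> R) (K : V -> V -> R).

Definition dotp x y : R := \sum_u x u * y u.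

Definition enorm x : R := Num.sqrt (dotp x x).

Definition kapp K x : V -> R := fun u => \sum_w K u w * x w.

Definition ktr K : V -> V -> R := fun u w => K w u.

Definition kmul K1 K2 : V -> V -> R := fun u w => \sum_a K1 u a * K2 a w.

Lemma dotp_ge0 x : 0 <= dotp x x.
Proof. by apply: sumr_ge0 => u _; rewrite -expr2 sqr_ge0. Qed.

Lemma enorm_ge0 x : 0 <= enorm x. Proof. exact: sqrtr_ge0. Qed.

Lemma enorm_sqr x : enorm x ^+ 2 = dotp x x.
Proof. by rewrite sqr_sqrtr // dotp_ge0. Qed.

Lemma enorm_gt0 x u : x u != 0 -> 0 < enorm x.
Proof.
move=> xu; rewrite sqrtr_gt0 /dotp (bigD1 u) //= ltr_wpDr //.
  by apply: sumr_ge0 => w _; rewrite -expr2 sqr_ge0.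
by rewrite -expr2 exprn_even_gt0.
Qed.

Lemma dotpDl x x' y : dotp (fun u => x u + x' u) y = dotp x y + dotp x' y.
Proof. by rewrite /dotp -big_split; apply: eq_bigr => u _; rewrite mulrDl. Qed.

Lemma dotpC x y : dotp x y = dotp y x.
Proof. by apply: eq_bigr => u _; rewrite mulrC. Qed.

Lemma eq_dotp x x' y y' : x =1 x' -> y =1 y' -> dotp x y = dotp x' y'.
Proof. by move=> ex ey; apply: eq_bigr => u _; rewrite ex ey. Qed.

Lemma eq_enorm x x' : x =1 x' -> enorm x = enorm x'.
Proof. by move=> ex; rewrite /enorm (eq_dotp ex ex). Qed.

Lemma enormZ c x : enorm (fun u => c * x u) = `|c| * enorm x.
Proof.
rewrite /enorm -sqrtr_sqr -sqrtrM ?sqr_ge0 //; congr Num.sqrt.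
by rewrite /dotp mulr_sumr; apply: eq_bigr => u _; ring.
Qed.

Lemma cauchy_schwarz x y : dotp x y <= enorm x * enorm y.
Proof.
have [x0|x0] := eqVneq (enorm x) 0.
  have xz u : x u = 0.
    by apply/eqP/negPn/negP => /enorm_gt0; rewrite x0 ltxx.
  by rewrite x0 mul0r /dotp big1 // => u _; rewrite xz mul0r.
set a := enorm x in x0 *; set b := enorm y.
have a0 : 0 < a by rewrite lt_neqAle eq_sym x0 enorm_ge0.
have : 0 <= dotp (fun u => b * x u - a * y u) (fun u => b * x u - a * y u).
  exact: dotp_ge0.
have -> : dotp (fun u => b * x u - a * y u) (fun u => b * x u - a * y u) =
    b ^+ 2 * dotp x x + a ^+ 2 * dotp y y - 2 * a * b * dotp x y.
  by rewrite /dotp !mulr_sumr -big_split -sumrB; apply: eq_bigr => u _ /=; ring.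
rewrite -!enorm_sqr -/a -/b => h.
have [b0|b0] := eqVneq b 0.
  have yz u : y u = 0.
    apply/eqP/negPn/negP => /enorm_gt0; by rewrite -/b b0 ltxx.
  by rewrite b0 mulr0 /dotp big1 // => u _; rewrite yz mulr0.
have b1 : 0 < b by rewrite lt_neqAle eq_sym b0 enorm_ge0.
rewrite -(ler_pM2l (mulr_gt0 a0 b1)); nra.
Qed.

Lemma enormD x y : enorm (fun u => x u + y u) <= enorm x + enorm y.
Proof.
rewrite -(@ler_pXn2r _ 2%N) ?nnegrE ?addr_ge0 ?enorm_ge0 //.
rewrite sqrrD !enorm_sqr dotpDl (dotpC x) (dotpC y) !dotpDl (dotpC y x).
have := cauchy_schwarz x y; lra.
Qed.

Lemma kappD K x y u : kapp K (fun w => x w + y w) u = kapp K x u + kapp K y u.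
Proof. by rewrite /kapp -big_split; apply: eq_bigr => w _; rewrite mulrDr. Qed.

Lemma kappZ K c x u : kapp K (fun w => c * x w) u = c * kapp K x u.
Proof. by rewrite /kapp mulr_sumr; apply: eq_bigr => w _; ring. Qed.

Lemma eq_kapp K x y : x =1 y -> kapp K x =1 kapp K y.
Proof. by move=> e u; apply: eq_bigr => w _; rewrite e. Qed.

Lemma kapp_kmul K1 K2 x u : kapp K1 (kapp K2 x) u = kapp (kmul K1 K2) x u.
Proof.
rewrite /kapp /kmul; under eq_bigr do rewrite mulr_sumr.
rewrite exchange_big; apply: eq_bigr => w _; rewrite mulr_suml.
by apply: eq_bigr => a _; rewrite mulrA.
Qed.

Lemma dotp_kapp K x y : dotp (kapp K x) y = dotp x (kapp (ktr K) y).
Proof.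
rewrite /dotp /kapp /ktr; under eq_bigr do rewrite mulr_suml.
rewrite exchange_big; apply: eq_bigr => w _; rewrite mulr_sumr.
by apply: eq_bigr => u _; ring.
Qed.

Definition knonneg K := forall u w, 0 <= K u w.

Definition gram_le K (c : R) :=
  forall u, \sum_v \sum_w K u w * K v w <= c.

(* Schur's test for the symmetric nonnegative kernel [K K^T]. *)
Lemma enorm_ktr_le K b x : knonneg K -> 0 <= b -> gram_le K (b ^+ 2) ->
  enorm (kapp (ktr K) x) <= b * enorm x.
Proof.
move=> K0 b0 Kb; rewrite -(@ler_pXn2r _ 2%N) ?nnegrE ?mulr_ge0 ?enorm_ge0 //.
rewrite exprMn !enorm_sqr.
pose G u v := \sum_w K u w * K v w.
have G0 u v : 0 <= G u v by apply: sumr_ge0 => w _; rewrite mulr_ge0.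
have GC u v : G u v = G v u by apply: eq_bigr => w _; rewrite mulrC.
have -> : dotp (kapp (ktr K) x) (kapp (ktr K) x) =
    \sum_u \sum_v G u v * (x u * x v).
  rewrite /dotp /kapp /ktr.
  under eq_bigr => w _ do
    (rewrite mulr_suml; under eq_bigr => u _ do rewrite mulr_sumr).
  rewrite exchange_big; apply: eq_bigr => u _ /=; rewrite exchange_big.
  by apply: eq_bigr => v _; rewrite /G mulr_suml; apply: eq_bigr => w _; ring.
have -> : b ^+ 2 * dotp x x = \sum_u b ^+ 2 * x u ^+ 2.
  by rewrite /dotp mulr_sumr; apply: eq_bigr => u _; rewrite expr2.
apply: (@le_trans _ _ (\sum_u \sum_v G u v * ((x u ^+ 2 + x v ^+ 2) / 2))).
  apply: ler_sum => u _; apply: ler_sum => v _; apply: ler_wpM2l => //.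
  by have := sqr_ge0 (x u - x v); rewrite sqrrB; lra.
have -> : \sum_u \sum_v G u v * ((x u ^+ 2 + x v ^+ 2) / 2) =
    \sum_u (\sum_v G u v) * x u ^+ 2.
  under eq_bigr => u _ do under eq_bigr => v _ do
    rewrite mulrDl mulrDr.
  under eq_bigr => u _ do rewrite big_split /=.
  rewrite big_split /= [X in _ + X]exchange_big /= -big_split /=.
  apply: eq_bigr => u _; rewrite -big_split /= mulr_suml.
  by apply: eq_bigr => v _; rewrite (GC v u); field.
by apply: ler_sum => u _; apply: ler_wpM2r; rewrite ?sqr_ge0 //; exact: Kb.
Qed.

Lemma enorm_kapp_le K b x : knonneg K -> 0 <= b -> gram_le K (b ^+ 2) ->
  enorm (kapp K x) <= b * enorm x.
Proof.
move=> K0 b0 Kb; set y := kapp K x.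
have := enorm_ge0 y; rewrite le_eqVlt => /orP[/eqP<-|y0].
  by rewrite mulr_ge0 ?enorm_ge0.
rewrite -(ler_pM2l y0) -expr2 enorm_sqr {1}/y dotp_kapp.
apply: le_trans (cauchy_schwarz _ _) _.
apply: le_trans (ler_wpM2l (enorm_ge0 _) (enorm_ktr_le y K0 b0 Kb)) _.
by rewrite le_eqVlt; apply/orP; left; apply/eqP; ring.
Qed.

Lemma gram_le_rows K r c : knonneg K -> 0 <= c ->
  (forall u, \sum_w K u w <= r) -> (forall w, \sum_u K u w <= c) ->
  gram_le K (r * c).
Proof.
move=> K0 c0 Kr Kc u; rewrite exchange_big /=.
apply: (@le_trans _ _ (\sum_w K u w * c)); last first.
  by rewrite -mulr_suml ler_wpM2r.
by apply: ler_sum => w _; rewrite -mulr_sumr ler_wpM2l.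
Qed.

End Kernels.

(* If [S] and [D] have norm at most [m] and nearly annihilate each other, then
   [lam S x = S^2 x + S D x + S R x] shows that [S x] is small compared to [x]
   as soon as [lam] exceeds [m]; likewise for [D x]. *)
Lemma perturbed_sum_eigen (R : realType) (V : finType) (KS KD KR : V -> V -> R)
    (lam m e r : R) (x : V -> R) :
  0 < m -> 0 <= e -> 0 <= r ->
  (forall y, enorm (kapp KS y) <= m * enorm y) ->
  (forall y, enorm (kapp KD y) <= m * enorm y) ->
  (forall y, enorm (kapp KR y) <= r * enorm y) ->
  (forall y, enorm (kapp KS (kapp KD y)) <= e * enorm y) ->
  (forall y, enorm (kapp KD (kapp KS y)) <= e * enorm y) ->
  (forall u, lam * x u = kapp KS x u + kapp KD x u + kapp KR x u) ->
  0 < enorm x -> lam <= m + 4 * (e / m) + 4 * r.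
Proof.
move=> m0 e0 r0 hS hD hR hSD hDS eigx x0.
have em0 : 0 <= e / m by rewrite divr_ge0 // ltW.
have [?|lam_m] := lerP lam m; first lra.
have lam0 : 0 < lam by apply: lt_trans lam_m.
set n := enorm x in x0 *; set s := enorm (kapp KS x); set d := enorm (kapp KD x).
have s0 : 0 <= s := enorm_ge0 _. have d0 : 0 <= d := enorm_ge0 _.
have lin (K : V -> V -> R) y c : (forall u, lam * y u = c u) ->
    lam * enorm (kapp K y) = enorm (kapp K c).
  move=> h; rewrite -{1}(ger0_norm (ltW lam0)) -enormZ; apply: eq_enorm => u.
  by rewrite -kappZ; apply: eq_kapp => w.
have tri : lam * n <= s + d + r * n.
  rewrite -{1}(ger0_norm (ltW lam0)) -enormZ (eq_enorm eigx).
  apply: le_trans (enormD _ _) (lerD _ (hR x)); exact: enormD.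
have split3 K u :
    kapp K (fun u => kapp KS x u + kapp KD x u + kapp KR x u) u =
    kapp K (kapp KS x) u + kapp K (kapp KD x) u + kapp K (kapp KR x) u.
  by rewrite !kappD.
have bs : lam * s <= m * s + e * n + m * (r * n).
  rewrite (lin KS x _ eigx) (eq_enorm (split3 KS)).
  apply: le_trans (enormD _ _) (lerD (le_trans (enormD _ _) (lerD _ _)) _).
  - exact: hS.
  - exact: hSD.
  - exact: le_trans (hS _) (ler_wpM2l (ltW m0) (hR x)).
have bd : lam * d <= e * n + m * d + m * (r * n).
  rewrite (lin KD x _ eigx) (eq_enorm (split3 KD)).
  apply: le_trans (enormD _ _) (lerD (le_trans (enormD _ _) (lerD _ _)) _).
  - exact: hDS.
  - exact: hD.
  - exact: le_trans (hD _) (ler_wpM2l (ltW m0) (hR x)).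
have sm : s <= m * n := hS x. have dm : d <= m * n := hD x.
have lam2 : lam <= 2 * m + r by rewrite -(ler_pM2r x0); lra.
have [rm|rm] := lerP r (m / 2); last lra.
have main : (lam - m) * (lam - r) <= 2 * e + 2 * (m * r).
  rewrite -(ler_pM2r x0).
  have : (lam - m) * ((lam - r) * n) <= (lam - m) * (s + d).
    by apply: ler_wpM2l; lra.
  lra.
have h2 : (lam - m) * (m / 2) <= 2 * e + 2 * (m * r).
  by apply: le_trans main; apply: ler_wpM2l; lra.
have eE : e = e / m * m by rewrite divfK // gt_eqF.
rewrite -(ler_pM2r m0); move: h2; rewrite {1}eE; nra.
Qed.

(** * Eigenvalues and the Rayleigh quotient *)

Lemma continuous_sumr (R : realType) (T : topologicalType) (I : Type)
    (r : seq I) (f : I -> T -> R) :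
  (forall i, continuous (f i)) -> continuous (fun t => \sum_(i <- r) f i t).
Proof.
move=> cf t; apply: (@cvg_big _ _ +%R 0 xpredT _ _ _ r f (f^~ t)) => [|i _].
- exact: add_continuous.
- exact: cf.
Qed.

(* The quadratic form attains its maximum [a] on the unit sphere at some [c];
   perturbing [c] in the direction [g = A c - a c] shows [g = 0]. *)
Lemma symmetric_rayleigh_eigenvalue (R : realType) (m : nat) (A : 'M[R]_m)
    (x : 'I_m -> R) :
  A^T = A -> 0 < enorm x ->
  exists2 a, eigenvalue A a & dotp x (kapp A x) <= a * dotp x x.
Proof.
move=> symA x0.
pose N (y : 'rV[R]_m) := \sum_i y 0 i * y 0 i.
pose Q (y : 'rV[R]_m) := \sum_i y 0 i * \sum_j A i j * y 0 j.
have cC i : continuous (fun y : 'rV[R]_m => y 0 i : R).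
  exact: (@coord_continuous R 1 m 0 i).
have cN : continuous N.
  apply: continuous_sumr => i y.
  by apply: continuousM; exact: cC.
have cQ : continuous Q.
  apply: continuous_sumr => i y.
  apply: (@continuousM _ _ (fun z : 'rV[R]_m => z 0 i : R)); first exact: cC.
  apply: continuous_sumr => j {}y.
  apply: (@continuousM _ _ (fun=> A i j) (fun z : 'rV[R]_m => z 0 j : R)).
    exact: cst_continuous.
  exact: cC.
pose S : set 'rV[R]_m := [set y | N y = 1]%classic.
have xx0 : 0 < dotp x x by rewrite -enorm_sqr exprn_gt0.
pose nrmz (y : 'I_m -> R) : 'rV[R]_m := \row_i (y i / enorm y).
have NS y : 0 < enorm y -> N (nrmz y) = 1.
  move=> y0; rewrite /N; under eq_bigr do rewrite !mxE.
  have -> : \sum_i (y i / enorm y) * (y i / enorm y) =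
      dotp y y / enorm y ^+ 2.
    by rewrite /dotp mulr_suml; apply: eq_bigr => i _; rewrite expr2 invfM; ring.
  by rewrite -enorm_sqr divff // expf_neq0 // gt_eqF.
have S0 : (S !=set0)%classic by exists (nrmz x); apply: NS.
have compS : compact S.
  apply: bounded_closed_compact.
    exists 1; split => //= M M1 y Sy.
    rewrite [leLHS]/Num.norm /= mx_normrE; apply/bigmax_leP; split=> [|[i j] _].
      by apply: le_trans (ltW M1).
    apply: le_trans (ltW M1); rewrite -(@ler_pXn2r _ 2%N) ?nnegrE //.
    rewrite expr1n real_normK ?num_real //= (ord1 i) -Sy /N (bigD1 j) //= -expr2.
    by rewrite lerDl; apply: sumr_ge0 => k _; rewrite -expr2 sqr_ge0.
  rewrite (_ : S = N @^-1` [set 1])%classic //.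
  apply: closed_comp; last exact: closed_eq.
  by move=> y _; exact: cN.
have [|c cS cmax] := @EVT_max_rV R m Q S S0 compS.
  exact: continuous_subspaceT.
have {}cS : N c = 1 by move: cS; rewrite inE.
pose a := Q c.
have ray (y : 'I_m -> R) : dotp y (kapp A y) <= a * dotp y y.
  have := enorm_ge0 y; rewrite le_eqVlt => /orP[/eqP y0|y0].
    rewrite -enorm_sqr -y0 expr0n mulr0 /= /dotp big1 // => i _.
    have /eqP -> : y i == 0; last by rewrite mul0r.
    by apply/negPn/negP => /enorm_gt0; rewrite -y0 ltxx.
  have h : Q (nrmz y) <= a by apply: cmax; rewrite inE; exact: NS.
  have QE : Q (nrmz y) * dotp y y = dotp y (kapp A y).
    rewrite -enorm_sqr /Q /dotp /kapp mulr_suml; apply: eq_bigr => i _.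
    rewrite !mxE mulr_sumr mulr_sumr mulr_suml; apply: eq_bigr => j _.
    by rewrite !mxE; field; rewrite gt_eqF.
  by rewrite -QE ler_wpM2r // dotp_ge0.
exists a; last exact: ray.
apply/eigenvalueP; exists c; last first.
  apply/negP => /eqP c0; move: cS; rewrite /N c0 big1; last first.
    by move=> i _; rewrite mxE mul0r.
  by move/esym/eqP; rewrite oner_eq0.
pose g (i : 'I_m) := kapp A (c 0) i - a * c 0 i.
have symK : forall i j, A i j = A j i by move=> i j; rewrite -{1}symA mxE.
have exp2 s : dotp (fun i => c 0 i + s * g i) (kapp A (fun i => c 0 i + s * g i))
   = a + 2 * s * dotp g (kapp A (c 0)) + s ^+ 2 * dotp g (kapp A g).
  have e i : kapp A (fun i => c 0 i + s * g i) i =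
      kapp A (c 0) i + s * kapp A g i by rewrite kappD kappZ.
  rewrite (eq_dotp (fun _ => erefl) e).
  have -> : dotp g (kapp A (c 0)) =
      (dotp g (kapp A (c 0)) + dotp (c 0) (kapp A g)) / 2.
    have -> : dotp (c 0) (kapp A g) = dotp g (kapp A (c 0)).
      rewrite dotpC dotp_kapp; apply: eq_dotp => // i.
      by apply: eq_bigr => j _; rewrite /ktr symK.
    by field.
  have -> : a = dotp (c 0) (kapp A (c 0)) by [].
  have -> (t1 t2 : R) : 2 * s * ((t1 + t2) / 2) = s * t1 + s * t2 by field.
  by rewrite /dotp !mulr_sumr -!big_split; apply: eq_bigr => i _ /=; ring.
have exp1 s : dotp (fun i => c 0 i + s * g i) (fun i => c 0 i + s * g i)
   = 1 + 2 * s * dotp g (c 0) + s ^+ 2 * dotp g g.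
  rewrite -[X in X + _ + _]cS.
  by rewrite /N /dotp !mulr_sumr -!big_split; apply: eq_bigr => i _ /=; ring.
have gg : dotp g g = dotp g (kapp A (c 0)) - a * dotp g (c 0).
  by rewrite /dotp mulr_sumr -sumrB; apply: eq_bigr => i _; rewrite {2}/g; ring.
pose Z := a * dotp g g - dotp g (kapp A g).
have Z0 : 0 <= Z by rewrite subr_ge0 ray.
have main s : 2 * s * dotp g g <= s ^+ 2 * Z.
  have := ray (fun i => c 0 i + s * g i); rewrite exp2 exp1 gg /Z gg; lra.
have g0 : enorm g = 0.
  apply/eqP/negPn/negP => g0.
  have {}g0 : 0 < dotp g g.
    by rewrite -enorm_sqr exprn_gt0 // lt_neqAle eq_sym g0 enorm_ge0.
  have := main (dotp g g / (Z + 1)).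
  have Z1 : 0 < Z + 1 by lra.
  have s0 : 0 < dotp g g / (Z + 1) by rewrite divr_gt0.
  set s := dotp g g / (Z + 1) in s0 *.
  have sE : s * (Z + 1) = dotp g g by rewrite /s divfK // gt_eqF.
  move=> h; have : s * (2 * dotp g g) <= s * (s * Z) by lra.
  rewrite (ler_pM2l s0); lra.
apply/rowP => j; rewrite !mxE.
have : g j = 0 by apply/eqP/negPn/negP => /enorm_gt0; rewrite g0 ltxx.
move/eqP; rewrite subr_eq0 => /eqP <-.
by apply: eq_bigr => i _; rewrite mulrC symK.
Qed.

Section LargestEigenvalue.
Variables (R : realType) (V : finType) (E : {set {set V}}).
Implicit Type x : V -> R.

Definition adjk : V -> V -> R := fun u w => (adjacent E u w)%:R.

Lemma adjacentC u w : adjacent E u w = adjacent E w u.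
Proof. by rewrite /adjacent finset.setUC. Qed.

Lemma adj_mx_eigenvector a : eigenvalue (adj_mx R E) a ->
  exists2 x, 0 < enorm x & forall u, a * x u = kapp adjk x u.
Proof.
move=> /eigenvalueP[v vA v0]; exists (fun u => v 0 (enum_rank u)).
  have /existsP[i vi] : [exists i, v 0 i != 0].
    apply: contraNT v0 => /existsPn h; apply/eqP/rowP => i; rewrite mxE.
    by apply/eqP/negPn; exact: h.
  by apply: (@enorm_gt0 _ _ _ (enum_val i)); rewrite enum_valK.
move=> u; have /rowP/(_ (enum_rank u)) := vA; rewrite !mxE => <-.
rewrite /kapp (reindex_onto enum_rank enum_val) /=; last first.
  by move=> i _; rewrite enum_valK.
apply: eq_big => w; first by rewrite enum_rankK eqxx.
by move=> _; rewrite !mxE !enum_rankK mulrC /adjk adjacentC.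
Qed.

Lemma lambda1_le b : 0 <= b ->
  (forall a x, 0 < enorm x -> (forall u, a * x u = kapp adjk x u) -> a <= b) ->
  lambda1 R E <= b.
Proof.
move=> b0 h; rewrite /lambda1 /largest_eigenvalue.
set S := [set a | _]%classic.
have ub : (ubound S b)%classic.
  by move=> a /adj_mx_eigenvector[x x0 ax]; exact: h ax.
have [->|/set0P S0] := eqVneq S set0; first by rewrite sup0.
exact: ge_sup.
Qed.

Lemma adj_rayleigh x : dotp x (kapp adjk x) <= lambda1 R E * dotp x x.
Proof.
have := enorm_ge0 x; rewrite le_eqVlt => /orP[/eqP x0|x0].
  rewrite -enorm_sqr -x0 expr0n mulr0 /= /dotp big1 // => i _.
  have /eqP -> : x i == 0; last by rewrite mul0r.
  by apply/negPn/negP => /enorm_gt0; rewrite -x0 ltxx.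
have re (F : V -> R) : \sum_u F u = \sum_(i < #|V|) F (enum_val i).
  rewrite (reindex_onto enum_val enum_rank) /=; last by move=> u _; rewrite enum_rankK.
  by apply: eq_bigl => i; rewrite enum_valK eqxx.
pose y (i : 'I_#|V|) := x (enum_val i).
have yy : dotp y y = dotp x x by rewrite /dotp re.
have yA : dotp y (kapp (adj_mx R E) y) = dotp x (kapp adjk x).
  rewrite /dotp re; apply: eq_bigr => i _; congr (_ * _).
  by rewrite /kapp re; apply: eq_bigr => j _; rewrite mxE.
have y0 : 0 < enorm y by rewrite /enorm yy.
have [|a ea ha] := @symmetric_rayleigh_eigenvalue _ _ (adj_mx R E) y _ y0.
  by apply/matrixP => i j; rewrite !mxE adjacentC.
rewrite -yA -yy; apply: le_trans ha _; apply: (ler_wpM2r (dotp_ge0 y)).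
apply: ub_le_sup => //; exists #|V|%:R => b /adj_mx_eigenvector[z z0 bz].
have K0 : knonneg adjk by move=> u w; rewrite ler0n.
have [b0|b0] := lerP b 0; first exact: le_trans b0 (ler0n _ _).
have : enorm (fun u => b * z u) <= #|V|%:R * enorm z.
  rewrite (eq_enorm bz); apply: enorm_kapp_le => // u.
  apply: (@le_trans _ _ (\sum_(v : V) \sum_(w : V) 1)).
    apply: ler_sum => v _; apply: ler_sum => w _.
    by rewrite /adjk; do 2!case: (adjacent _ _ _); rewrite ?mulr0 ?mul0r ?mulr1.
  by rewrite !sumr_const -mulrnA expr2 -natrM.
by rewrite enormZ (ger0_norm (ltW b0)) ler_pM2r.
Qed.

End LargestEigenvalue.

(** * Graphs whose high degree vertices are sparse *)

Section SpectralBound.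
Variables (R : realType) (V : finType) (E : {set {set V}}).
Variables (N1 N2 : V -> {set V}).
Hypothesis codeg2 : forall u v, u != v ->
  (#|[set w | adjacent E u w & adjacent E v w]%SET| <= 2)%N.
Hypothesis adjN1 : forall u v, adjacent E u v -> v \in N1 u.
Hypothesis adjN2 : forall u v w, adjacent E u v -> adjacent E v w -> w \in N2 u.

Let deg v : R := (degree E v)%:R.

Lemma sum_boolr (P : pred V) : \sum_w (P w)%:R = #|[set w | P w]%SET|%:R :> R.
Proof.
rewrite -natr_sum -sum1_card; congr (_%:R); rewrite [RHS]big_mkcond.
by apply: eq_bigr => w _; rewrite inE; case: (P w).
Qed.

Lemma sum_boolr_in (A : {set V}) (P : pred V) :
  \sum_w ((w \in A) && P w)%:R = \sum_(w in A | P w) 1 :> R.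
Proof. by rewrite [RHS]big_mkcond; apply: eq_bigr => w _; case: ifP. Qed.

Definition subk (U W : pred V) : V -> V -> R :=
  fun u w => [&& adjacent E u w, U u & W w]%:R.

Lemma subk_ge0 U W : knonneg (subk U W). Proof. by move=> u w; rewrite ler0n. Qed.

Lemma subk_row U W u : \sum_w subk U W u w <= deg u.
Proof.
rewrite /deg /degree -sum_boolr; apply: ler_sum => w _.
by rewrite ler_nat /subk; case: adjacent => //=; case: (_ && _).
Qed.

Lemma codeg_le2 (U W : pred V) u v : u != v ->
  \sum_w subk U W u w * subk U W v w <= 2.
Proof.
move=> uv; apply: le_trans (_ : #|[set w | adjacent E u w & adjacent E v w]%SET|%:R <= _).
  rewrite -sum_boolr; apply: ler_sum => w _; rewrite -natrM ler_nat.
  by case: (adjacent E u w); case: (adjacent E v w); rewrite /= ?muln0 //;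
    do 2!case: (_ && _).
by rewrite (ler_nat R _ 2) codeg2.
Qed.

Lemma gram_subk (U W : pred V) (d s : R) : 0 <= d -> 0 <= s ->
  (forall u, U u -> \sum_w subk U W u w <= d) ->
  (forall u, \sum_(v in N2 u | U v) 1 <= s) ->
  gram_le (subk U W) (d + 2 * s).
Proof.
move=> d0 s0 hd hs u; have [Uu|/negbTE nU] := boolP (U u); last first.
  rewrite big1 ?addr_ge0 ?mulr_ge0 // => v _; rewrite big1 // => w _.
  by rewrite /subk nU andbF mul0r.
rewrite (bigD1 u) //=; apply: lerD.
  apply: le_trans (hd _ Uu); apply: ler_sum => w _; rewrite -natrM ler_nat.
  by case: [&& _, _ & _].
apply: (@le_trans _ _ (2 * \sum_v ((v \in N2 u) && U v)%:R)); last first.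
  by rewrite ler_pM2l // sum_boolr_in hs.
rewrite mulr_sumr [leRHS](bigD1 u) //= ler_wpDl ?mulr_ge0 //.
apply: ler_sum => v vu; have [h|/negbTE h] := boolP ((v \in N2 u) && U v).
  by rewrite mulr1 codeg_le2 // eq_sym.
rewrite mulr0 big1 // => w _; rewrite /subk -natrM.
move: h; case: (boolP (U v)) => [_|_ _]; last by rewrite andbF muln0.
rewrite andbT => h; have [uw|] := boolP (adjacent E u w); last by rewrite mul0n.
have [vw|] := boolP (adjacent E v w); last by rewrite muln0.
by move: h; rewrite (adjN2 uw) // adjacentC.
Qed.

Lemma bipartite_norm (U W : pred V) (b : R) (x : V -> R) :
  (forall v, U v -> W v = false) -> 0 <= b -> gram_le (subk U W) (b ^+ 2) ->
  enorm (kapp (fun u w => subk U W u w + ktr (subk U W) u w) x) <= b * enorm x.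
Proof.
move=> UW b0 gB; set B := subk U W.
pose xU v := (U v)%:R * x v; pose xW v := (W v)%:R * x v.
have BW u : kapp B x u = kapp B xW u.
  apply: eq_bigr => w _; rewrite /xW /B /subk.
  by case: (W w); rewrite ?mul1r // !andbF !mul0r.
have BU u : kapp (ktr B) x u = kapp (ktr B) xU u.
  apply: eq_bigr => w _; rewrite /xU /ktr /B /subk.
  by case: (U w); rewrite ?mul1r // !andbF !mul0r.
rewrite -(@ler_pXn2r _ 2%N) ?nnegrE ?mulr_ge0 ?enorm_ge0 //.
have -> : enorm (kapp (fun u w => B u w + ktr B u w) x) ^+ 2 =
    enorm (kapp B xW) ^+ 2 + enorm (kapp (ktr B) xU) ^+ 2.
  rewrite !enorm_sqr /dotp -big_split; apply: eq_bigr => u _ /=.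
  have -> : kapp (fun u w => B u w + ktr B u w) x u = kapp B xW u + kapp (ktr B) xU u.
    rewrite -BW -BU /kapp -big_split; apply: eq_bigr => w _; exact: mulrDl.
  suff h : kapp B xW u * kapp (ktr B) xU u = 0.
    by rewrite mulrDl !mulrDr h (mulrC (kapp (ktr B) xU u)) h addr0 add0r.
  have [Uu|/negbTE nU] := boolP (U u).
    rewrite [X in _ * X]big1 ?mulr0 // => w _.
    by rewrite /ktr /B /subk (UW u) // !andbF mul0r.
  by rewrite [X in X * _]big1 ?mul0r // => w _; rewrite /B /subk nU andbF mul0r.
have h1 : enorm (kapp B xW) <= b * enorm xW.
  by apply: enorm_kapp_le => //; exact: subk_ge0.
have h2 : enorm (kapp (ktr B) xU) <= b * enorm xU.
  by apply: enorm_ktr_le => //; exact: subk_ge0.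
have h3 : enorm xW ^+ 2 + enorm xU ^+ 2 <= enorm x ^+ 2.
  rewrite !enorm_sqr /dotp -big_split; apply: ler_sum => u _ /=.
  rewrite /xW /xU; have [Uu|nU] := boolP (U u).
    by rewrite (UW u) // !mul0r add0r !mul1r.
  rewrite !mul0r addr0; case: (W u); rewrite ?mul1r // !mul0r -expr2.
  exact: sqr_ge0.
apply: (@le_trans _ _ ((b * enorm xW) ^+ 2 + (b * enorm xU) ^+ 2)).
  by apply: lerD; rewrite ler_pXn2r ?nnegrE ?mulr_ge0 ?enorm_ge0.
by rewrite !exprMn -mulrDr ler_wpM2l // sqr_ge0.
Qed.

Lemma gram_leW (K : V -> V -> R) c c' : c <= c' -> gram_le K c -> gram_le K c'.
Proof. by move=> cc gK u; exact: le_trans (gK u) cc. Qed.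

Section Threshold.
Variables (t X : R).
Hypothesis t0 : 0 < t.
Hypothesis hX1 : forall v, \sum_(w in N1 v | t < deg w) deg w <= X.
Hypothesis hX2 : forall v, \sum_(w in N2 v | t < deg w) deg w <= X.

Lemma high_count (N : V -> {set V}) (P : pred V) (c : R) v : 0 < c ->
  (forall v, \sum_(w in N v | t < deg w) deg w <= X) ->
  (forall w, P w -> (t < deg w) && (c <= deg w)) ->
  \sum_(w in N v | P w) 1 <= X / c.
Proof.
move=> c0 hX hP; rewrite ler_pdivlMr // mulr_suml.
apply: le_trans (hX v); rewrite big_mkcond [leRHS]big_mkcond.
apply: ler_sum => w _; case: (w \in N v) => //=; case: ifP => [/hP/andP[-> h]|_].
  by rewrite mul1r.
by case: ifP => // _; exact: ler0n.
Qed.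

(* The vertices are split into low ([degree <= t]), medium and high
   ([degree > s]) ones. The edges inside the low part and those between low and
   high vertices are the two main contributions; all others are negligible. *)
Lemma eigenvalue_le_of_sparse_high (s m e r1 r2 : R) (a : R) (x : V -> R) :
  0 < s -> 0 < m -> 0 <= e -> 0 <= r1 -> 0 <= r2 -> t <= m ->
  (max_degree E)%:R + 2 * (X / s) <= m ^+ 2 ->
  (max_degree E)%:R * t * (2 * (X / s)) <= e ^+ 2 ->
  3 * (X / t) <= r1 ^+ 2 ->
  s + 2 * (X / t) <= r2 ^+ 2 ->
  0 < enorm x -> (forall u, a * x u = kapp (adjk R E) x u) ->
  a <= m + 4 * (e / m) + 4 * (r1 + r2).
Proof.
move=> s0 m0 e0 r10 r20 tm hm he hr1 hr2 x0 ax.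
have X0 : 0 <= X.
  have [v _|V0] := pickP (@predT V); last first.
    by move: x0; rewrite /enorm /dotp big_pred0 ?sqrtr0 ?ltxx.
  by apply: le_trans (hX1 v); apply: sumr_ge0 => w _; exact: ler0n.
have degD v : deg v <= (max_degree E)%:R.
  by rewrite ler_nat; apply: (leq_bigmax v).
pose L v := deg v <= t; pose N v := t < deg v.
pose M v := (t < deg v) && (deg v <= s); pose H v := (t < deg v) && (s < deg v).
have sH v : \sum_(w in N2 v | H w) 1 <= X / s.
  by apply: high_count => // w /andP[-> /ltW ->].
have sN v : \sum_(w in N2 v | N w) 1 <= X / t.
  by apply: high_count => // w tw; apply/andP; split; rewrite ?(ltW tw).
have sN1 v : \sum_(w in N1 v | N w) 1 <= X / t.
  by apply: high_count => // w tw; apply/andP; split; rewrite ?(ltW tw).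
have sM v : \sum_(w in N2 v | M w) 1 <= X / t.
  by apply: high_count => // w /andP[tw _]; rewrite tw ltW.
have Xs0 : 0 <= X / s by rewrite divr_ge0 // ltW.
have Xt0 : 0 <= X / t by rewrite divr_ge0 // ltW.
have HL v : H v -> L v = false by rewrite /H /L ltNge => /andP[/negbTE].
have ML v : M v -> L v = false by rewrite /M /L ltNge => /andP[/negbTE].
pose B := subk H L; pose D := subk L L.
have DC u w : D u w = D w u.
  by rewrite /D /subk adjacentC; case: (L u); case: (L w).
have D0 : knonneg D := subk_ge0 _ _. have B0 : knonneg B := subk_ge0 _ _.
have Drow u : \sum_w D u w <= t.
  have [Lu|nL] := boolP (L u); first exact: le_trans (subk_row _ _ _) Lu.
  rewrite big1 ?(ltW t0) // => w _; rewrite /D /subk (negbTE nL) andbF //.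
have Dcol w : \sum_u D u w <= t by under eq_bigr do rewrite DC; exact: Drow.
have gBD : gram_le (kmul B D) (e ^+ 2).
  apply: gram_leW he _; apply: gram_le_rows.
  - by move=> u w; apply: sumr_ge0 => v _; rewrite mulr_ge0.
  - by rewrite mulr_ge0.
  - move=> u; rewrite exchange_big /=.
    apply: (@le_trans _ _ (\sum_v B u v * t)).
      by apply: ler_sum => v _; rewrite -mulr_sumr ler_wpM2l.
    rewrite -mulr_suml ler_wpM2r ?(ltW t0) //.
    exact: le_trans (subk_row _ _ _) (degD u).
  - move=> w; apply: (@le_trans _ _ (2 * \sum_v ((v \in N2 w) && H v)%:R)); last first.
      by rewrite ler_pM2l // sum_boolr_in.
    rewrite mulr_sumr; apply: ler_sum => v _.
    have [h|/negbTE h] := boolP ((v \in N2 w) && H v).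
      rewrite mulr1; have [Lw|nLw] := boolP (L w); last first.
        by rewrite /kmul big1 // => b _; rewrite /D /subk (negbTE nLw) !andbF mulr0.
      have vw : v != w.
        by apply/eqP => vw; case/andP: h => _ /HL; rewrite vw Lw.
      apply: le_trans (codeg_le2 predT predT vw).
      apply: ler_sum => b _; rewrite /B /D /subk (adjacentC E b w).
      rewrite -!natrM ler_nat.
      by case: adjacent; case: adjacent; rewrite /= ?muln0 //; do 2!case: (_ && _).
    rewrite mulr0 /kmul big1 // => b _; rewrite /B /D /subk -natrM.
    move: h; case: (boolP (H v)) => [_|_ _]; last by rewrite andbF mul0n.
    rewrite andbT => h; have [vb|] := boolP (adjacent E v b); last by rewrite mul0n.
    have [bw|] := boolP (adjacent E b w); last by rewrite muln0.
    by move: h; rewrite (@adjN2 w b v) // adjacentC.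
pose KS u w := B u w + ktr B u w.
pose KM u w := subk M L u w + ktr (subk M L) u w.
pose KR u w := subk N N u w + KM u w.
have SD y u : kapp KS (kapp D y) u = kapp (kmul B D) y u.
  rewrite -kapp_kmul; apply: eq_bigr => w _; rewrite /KS mulrDl -[RHS]addr0.
  congr (_ + _); have [Lw|nLw] := boolP (L w).
    rewrite /ktr /B /subk; case: (boolP (H w)) => [/HL|]; first by rewrite Lw.
    by rewrite andbF mul0r.
  by rewrite [X in _ * X]big1 ?mulr0 // => v _; rewrite /D /subk (negbTE nLw) andbF mul0r.
have DS y u : kapp D (kapp KS y) u = kapp (ktr (kmul B D)) y u.
  have -> : kapp (ktr (kmul B D)) y u = kapp (kmul D (ktr B)) y u.
    apply: eq_bigr => w _; congr (_ * _); apply: eq_bigr => v _.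
    by rewrite /ktr mulrC DC.
  rewrite -kapp_kmul; apply: eq_bigr => w _.
  have [Lw|nLw] := boolP (L w); last by rewrite /D /subk (negbTE nLw) !andbF !mul0r.
  congr (_ * _); apply: eq_bigr => v _; rewrite /KS mulrDl -[RHS]add0r.
  congr (_ + _); rewrite /B /subk; case: (boolP (H w)) => [/HL|]; first by rewrite Lw.
  by rewrite andbF mul0r.
apply: (@perturbed_sum_eigen _ _ KS D KR a m e (r1 + r2) x) => //.
- exact: addr_ge0.
- move=> y; apply: bipartite_norm (ltW m0) _; first exact: HL.
  apply: gram_leW hm _; apply: gram_subk => // u _.
  exact: le_trans (subk_row _ _ _) (degD u).
- move=> y; apply: le_trans (ler_wpM2r (enorm_ge0 _) tm).
  apply: enorm_kapp_le (ltW t0) _ => //; rewrite expr2.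
  by apply: gram_le_rows => //; exact: ltW.
- move=> y; have -> : enorm (kapp KR y) =
      enorm (fun u => kapp (subk N N) y u + kapp KM y u).
    apply: eq_enorm => u; rewrite /kapp -big_split; apply: eq_bigr => w _.
    exact: mulrDl.
  apply: le_trans (enormD _ _) _; rewrite mulrDl; apply: lerD.
    apply: enorm_kapp_le (@subk_ge0 N N) r10 _.
    apply: (@gram_leW _ (X / t + 2 * (X / t))); first lra.
    apply: gram_subk => // u _; apply: le_trans (sN1 u).
    rewrite -sum_boolr_in; apply: ler_sum => w _; rewrite ler_nat.
    by case: (boolP (adjacent E u w)) => //= /adjN1 ->; case: (N u).
  apply: bipartite_norm => //; apply: gram_leW hr2 _; apply: gram_subk => //.
    exact: ltW.
  by move=> u /andP[_ us]; exact: le_trans (subk_row _ _ _) us.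
- by move=> y; rewrite (eq_enorm (SD y)); apply: enorm_kapp_le => // u w;
    apply: sumr_ge0 => v _; rewrite mulr_ge0.
- by move=> y; rewrite (eq_enorm (DS y)); apply: enorm_ktr_le => // u w;
    apply: sumr_ge0 => v _; rewrite mulr_ge0.
move=> u; rewrite ax /kapp -!big_split; apply: eq_bigr => w _ /=.
rewrite -!mulrDl; congr (_ * _).
rewrite /KR /KM /KS /ktr /B /D /adjk /subk (adjacentC E w u) /H /L /N /M.
case: adjacent; rewrite /= ?addr0 //.
case: (leP (deg u) t) => ut; case: (leP (deg w) t) => wt /=;
  case: (leP (deg u) s) => us; case: (leP (deg w) s) => ws /=; rewrite ?addr0 ?add0r //.
Qed.

End Threshold.
End SpectralBound.

(** * Geometry of the cube *)

Section LowerBounds.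
Variables (R : realType) (V : finType) (E : {set {set V}}).
Hypothesis noloop : forall v, adjacent E v v = false.

Lemma lambda1_ge0 (v : V) : 0 <= lambda1 R E.
Proof.
pose x u : R := (u == v)%:R.
have xx : dotp x x = 1.
  rewrite /dotp (bigD1 v) //= /x eqxx mulr1 big1 ?addr0 // => u /negbTE ->.
  by rewrite mul0r.
rewrite -[lambda1 R E]mulr1 -xx; apply: le_trans (adj_rayleigh E x).
apply: sumr_ge0 => u _; rewrite mulr_ge0 ?ler0n //.
by apply: sumr_ge0 => w _; rewrite mulr_ge0 ?ler0n.
Qed.

(* Test vector: [sqrt d] at [v] and [1] on its [d] neighbours, the top
   eigenvector of the star. *)
Lemma sqrt_degree_le_lambda1 (v : V) : Num.sqrt (degree E v)%:R <= lambda1 R E.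
Proof.
have [->|d0] := posnP (degree E v); first by rewrite sqrtr0 lambda1_ge0.
set d : R := (degree E v)%:R; pose s := Num.sqrt d.
have d1 : 0 < d by rewrite ltr0n.
have s0 : 0 <= s := sqrtr_ge0 _.
have ss : s * s = d by rewrite -expr2 sqr_sqrtr // ltW.
have dE : \sum_w (adjacent E v w)%:R = d by rewrite sum_boolr.
pose x u : R := if u == v then s else (adjacent E v u)%:R.
have x0 u : 0 <= x u by rewrite /x; case: ifP.
have dE' : \sum_(w | w != v) (adjacent E v w)%:R = d.
  by rewrite -dE [RHS](bigD1 v) //= noloop add0r.
have xx : dotp x x = d + d.
  rewrite /dotp (bigD1 v) //= {1 2}/x eqxx ss -[X in _ = _ + X]dE'; congr (_ + _).
  apply: eq_bigr => u /negbTE uv; rewrite /x uv.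
  by case: adjacent; rewrite ?mulr1 ?mulr0.
have xAx : s * (d + d) <= dotp x (kapp (adjk R E) x).
  rewrite /dotp (bigD1 v) //= mulrDr; apply: lerD.
    rewrite {1}/x eqxx ler_wpM2l // -dE' /kapp [leRHS](bigD1 v) //= ler_wpDl //.
      by rewrite mulr_ge0 // ler0n.
    apply: ler_sum => w /negbTE wv; rewrite /x wv /adjk.
    by case: adjacent; rewrite ?mulr1 ?mulr0.
  rewrite -dE' mulr_sumr; apply: ler_sum => u /negbTE uv.
  rewrite {1}/x uv; have [vu|] := boolP (adjacent E v u); last first.
    by rewrite mulr0 mul0r.
  rewrite mulr1 mul1r /kapp (bigD1 v) //= {1}/x eqxx /adjk adjacentC vu mul1r.
  by rewrite lerDl; apply: sumr_ge0 => w _; rewrite mulr_ge0 ?ler0n.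
rewrite -(@ler_pM2r _ (d + d)) ?addr_gt0 // -{2}xx.
exact: le_trans xAx (adj_rayleigh E x).
Qed.

Lemma average_degree_le_lambda1 :
  \sum_v (degree E v)%:R <= lambda1 R E * #|V|%:R.
Proof.
have := @adj_rayleigh R V E (fun=> 1).
have -> : dotp (fun _ : V => 1 : R) (fun=> 1) = #|V|%:R.
  by rewrite /dotp; under eq_bigr do rewrite mulr1; rewrite sumr_const.
apply: le_trans; rewrite le_eqVlt; apply/orP; left; apply/eqP.
apply: eq_bigr => v _; rewrite mul1r /kapp /adjk -sum_boolr.
by apply: eq_bigr => w _; rewrite mulr1.
Qed.

End LowerBounds.

Section CubeGeometry.
Variable n : nat.
Implicit Types u v w : cube n.

Definition flip v (i : 'I_n) : cube n := [ffun j => v j (+) (j == i)].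

Definition parity v : bool := \big[addb/false]_i v i.

Definition ball1 v : {set cube n} := [set flip v i | i in 'I_n]%SET.

(* Contains [v] itself as soon as [n > 0]. *)
Definition ball2 v : {set cube n} :=
  [set flip (flip v ij.1) ij.2 | ij in {: 'I_n * 'I_n}]%SET.

Lemma cube_adjP v w : reflect (exists i, w = flip v i) (cube_adj v w).
Proof.
apply: (iffP cards1P) => [[i hi]|[i ->]]; exists i.
  apply/ffunP => j; rewrite ffunE; move/finset.setP: hi => /(_ j); rewrite !inE.
  by move=> <-; case: (v j) (w j) => [] [].
apply/finset.setP => j; rewrite !inE ffunE.
by case: (v j) => /=; case: (j == i).
Qed.

Lemma cube_adjC v w : cube_adj v w = cube_adj w v.
Proof.
by rewrite /cube_adj; congr (_ == _); apply: eq_card => i; rewrite !inE eq_sym.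
Qed.

Lemma cube_adj_irr v : cube_adj v v = false.
Proof.
rewrite /cube_adj (_ : [set _ | _]%SET = finset.set0) ?cards0 //.
by apply/finset.setP => i; rewrite !inE eqxx.
Qed.

Lemma parity_flip v i : parity (flip v i) = ~~ parity v.
Proof.
rewrite /parity; under eq_bigr do rewrite ffunE.
rewrite big_split /= [X in _ (+) X](bigD1 i) //= eqxx [X in true (+) X]big1.
  by rewrite addbT.
by move=> j /negbTE.
Qed.

Lemma flip_inj v : injective (flip v).
Proof.
move=> i j /ffunP/(_ i); rewrite !ffunE eqxx => /addbI/esym/eqP //.
Qed.

Lemma cube_adj_parity v w : cube_adj v w -> parity w = ~~ parity v.
Proof. by move=> /cube_adjP[i ->]; exact: parity_flip. Qed.

Lemma card_ball1 v : (#|ball1 v| <= n)%N.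
Proof. by rewrite -[X in (_ <= X)%N]card_ord; exact: leq_imset_card. Qed.

Lemma card_ball2 v : (#|ball2 v| <= n ^ 2)%N.
Proof.
apply: leq_trans (leq_imset_card _ _) _.
by rewrite card_prod card_ord mulnn.
Qed.

Lemma mem_ball1 v w : cube_adj v w -> w \in ball1 v.
Proof. by move=> /cube_adjP[i ->]; exact: imset_f. Qed.

Lemma mem_ball2 u v w : cube_adj u v -> cube_adj v w -> w \in ball2 u.
Proof.
move=> /cube_adjP[i ->] /cube_adjP[j ->].
by apply/imsetP; exists (i, j); rewrite ?inE.
Qed.

Lemma ball1_parity v w : w \in ball1 v -> parity w = ~~ parity v.
Proof. by move=> /imsetP[i _ ->]; exact: parity_flip. Qed.

Lemma ball2_parity v w : w \in ball2 v -> parity w = parity v.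
Proof. by move=> /imsetP[i _ ->]; rewrite !parity_flip negbK. Qed.

Lemma cube_codegree u v : u != v ->
  (#|[set w | cube_adj u w & cube_adj v w]%SET| <= 2)%N.
Proof.
move=> uv; set S := [set w | _ & _]%SET.
have [->|/set0Pn[w0]] := eqVneq S finset.set0; first by rewrite cards0.
pose D := [set k | u k != v k]%SET.
have key i j : flip u i = flip v j -> i \in D /\ D \subset [set i; j]%SET.
  move=> /ffunP e; have ij : i != j.
    apply: contraNneq uv => ij; apply/eqP/ffunP => k.
    by have := e k; rewrite !ffunE ij => /addIb.
  split.
    have := e i; rewrite !inE !ffunE eqxx (negbTE ij).
    by case: (u i); case: (v i).
  apply/fintype.subsetP => k; have := e k; rewrite !inE !ffunE.
  by case: (k == i); case: (k == j) => //=; rewrite !addbF => ->; rewrite eqxx.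
rewrite inE => /andP[/cube_adjP[i0 e0] /cube_adjP[j0 f0]].
have [_ DS] : i0 \in D /\ D \subset [set i0; j0]%SET by apply: key; rewrite -e0 -f0.
have D2 : (#|D| <= 2)%N.
  by apply: leq_trans (subset_leq_card DS) _; rewrite cards2; case: (i0 != j0).
apply: leq_trans D2; apply: leq_trans (leq_imset_card (flip u) D).
apply: subset_leq_card; apply/fintype.subsetP => w.
rewrite inE => /andP[/cube_adjP[i e] /cube_adjP[j f]].
rewrite e; apply: imset_f.
by have [|//] := key i j; rewrite -e -f.
Qed.

Section Subgraph.
Variable E : {set {set cube n}}.
Hypothesis subE : E \subset cube_edges n.

Lemma adjacent_cube u w : adjacent E u w -> cube_adj u w.
Proof.
move=> /(fintype.subsetP subE); rewrite inE => /existsP[x /existsP[y /andP[xy /eqP e]]].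
have uxy : u \in [set x; y]%SET by rewrite -e set21.
have wxy : w \in [set x; y]%SET by rewrite -e set22.
have xuw : x \in [set u; w]%SET by rewrite e set21.
have yuw : y \in [set u; w]%SET by rewrite e set22.
have nxy : x != y by apply: contraTneq xy => ->; rewrite cube_adj_irr.
move: uxy wxy xuw yuw; rewrite !inE.
move=> /orP[]/eqP -> /orP[]/eqP -> //; rewrite ?(cube_adjC y) //.
  by rewrite !orbb (eq_sym y) (negbTE nxy).
by rewrite !orbb (negbTE nxy).
Qed.

Lemma degree_edges v : degree E v = #|[set e in E | v \in e]%SET|.
Proof.
rewrite /degree -(@card_in_imset _ _ (fun w => [set v; w]%SET)) /=.
  apply: eq_card => e; apply/imsetP/idP => [[w]|].
    by rewrite !inE => vw ->; rewrite set21 andbT.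
  rewrite inE => /andP[eE ve].
  have := fintype.subsetP subE _ eE; rewrite inE.
  move=> /existsP[x /existsP[y /andP[xy /eqP ee]]].
  move: ve eE; rewrite ee !inE => /orP[]/eqP -> eE.
    by exists y; rewrite ?inE /adjacent.
  by exists x; rewrite ?inE /adjacent finset.setUC.
move=> w w'; rewrite !inE => vw vw' e.
have : w \in [set v; w']%SET by rewrite -e set22.
rewrite !inE => /orP[/eqP wv|/eqP //].
by move: (adjacent_cube vw); rewrite wv cube_adj_irr.
Qed.

Lemma sum_degree : (\sum_v degree E v = #|E|.*2)%N.
Proof.
have deg2 v : degree E v = (\sum_(e in E) (v \in e))%N.
  rewrite degree_edges -sum1_card big_mkcond [RHS]big_mkcond.
  by apply: eq_bigr => e _; rewrite !inE; case: (e \in E); case: (v \in e).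
under eq_bigr do rewrite deg2.
rewrite exchange_big /= -muln2 -sum_nat_const; apply: eq_bigr => e eE.
transitivity #|e|; first by rewrite -sum1_card [RHS]big_mkcond;
  apply: eq_bigr => v _; case: (v \in e).
have := fintype.subsetP subE _ eE; rewrite inE.
move=> /existsP[x /existsP[y /andP[xy /eqP ->]]]; rewrite cards2.
by case: eqVneq xy => // ->; rewrite cube_adj_irr.
Qed.

Lemma max_degree_le : (max_degree E <= n)%N.
Proof.
apply/bigmax_leqP => v _; apply: leq_trans (card_ball1 v).
apply: subset_leq_card; apply/fintype.subsetP => w; rewrite inE => /adjacent_cube.
exact: mem_ball1.
Qed.

Lemma adjacent_irr v : adjacent E v v = false.
Proof. by apply/negP => /adjacent_cube; rewrite cube_adj_irr. Qed.

Lemma adjacent_codegree u v : u != v ->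
  (#|[set w | adjacent E u w & adjacent E v w]%SET| <= 2)%N.
Proof.
move=> uv; apply: leq_trans (cube_codegree uv); apply: subset_leq_card.
by apply/fintype.subsetP => w; rewrite !inE => /andP[/adjacent_cube -> /adjacent_cube ->].
Qed.

Variable R : realType.

Lemma sqrt_max_degree_le_lambda1 : Num.sqrt (max_degree E)%:R <= lambda1 R E.
Proof.
have [v ->] : {v | max_degree E = degree E v}.
  by apply: bigop.eq_bigmax; rewrite card_ffun card_bool card_ord expn_gt0.
by apply: sqrt_degree_le_lambda1; exact: adjacent_irr.
Qed.

Lemma card_edges_le_lambda1 : #|E|.*2%:R <= lambda1 R E * 2 ^+ n.
Proof.
have := @average_degree_le_lambda1 R _ E.
by rewrite -natr_sum sum_degree card_ffun card_bool card_ord natrX.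
Qed.

Lemma lambda1_le_of_sparse_high (t X s m e r1 r2 : R) :
  0 < t -> 0 < s -> 0 < m -> 0 <= e -> 0 <= r1 -> 0 <= r2 -> t <= m ->
  (forall v, \sum_(w in ball1 v | t < (degree E w)%:R) (degree E w)%:R <= X) ->
  (forall v, \sum_(w in ball2 v | t < (degree E w)%:R) (degree E w)%:R <= X) ->
  (max_degree E)%:R + 2 * (X / s) <= m ^+ 2 ->
  (max_degree E)%:R * t * (2 * (X / s)) <= e ^+ 2 ->
  3 * (X / t) <= r1 ^+ 2 ->
  s + 2 * (X / t) <= r2 ^+ 2 ->
  lambda1 R E <= m + 4 * (e / m) + 4 * (r1 + r2).
Proof.
move=> t0 s0 m0 e0 r10 r20 tm h1 h2 hm he hr1 hr2; apply: lambda1_le.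
  by have : 0 <= e / m by [rewrite divr_ge0 // ltW]; lra.
move=> a x x0 ax.
apply: (@eigenvalue_le_of_sparse_high R _ E ball1 ball2 _ _ _ t X _ _ _ s) ax => //.
- exact: adjacent_codegree.
- by move=> u v /adjacent_cube; exact: mem_ball1.
- by move=> u v w /adjacent_cube uv /adjacent_cube; exact: mem_ball2.
Qed.

Lemma lambda1_le_max_degree : lambda1 R E <= (max_degree E)%:R.
Proof.
apply: lambda1_le => // a x x0 ax.
have [a0|a0] := lerP a 0; first exact: le_trans a0 (ler0n _ _).
have : enorm (fun u => a * x u) <= (max_degree E)%:R * enorm x.
  have K0 : knonneg (adjk R E) by move=> u w; rewrite ler0n.
  have row u : \sum_w adjk R E u w <= (max_degree E)%:R.
    by rewrite /adjk sum_boolr ler_nat; exact: (leq_bigmax u).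
  rewrite (eq_enorm ax); apply: enorm_kapp_le => //; rewrite expr2.
  apply: gram_le_rows => // w; under eq_bigr do rewrite /adjk adjacentC.
  exact: row.
by rewrite enormZ (ger0_norm (ltW a0)) ler_pM2r.
Qed.

End Subgraph.

Lemma flip_edge v i : [set v; flip v i]%SET \in cube_edges n.
Proof.
rewrite inE; apply/existsP; exists v; apply/existsP; exists (flip v i).
by rewrite eqxx andbT; apply/cube_adjP; exists i.
Qed.

Lemma degree_cube_edges v : degree (cube_edges n) v = n.
Proof.
rewrite /degree -[RHS]card_ord -(card_imset _ (@flip_inj v)).
apply: eq_card => w; rewrite inE; apply/idP/imsetP => [|[i _ ->]].
  by move=> /(adjacent_cube (subxx _))/cube_adjP[i ->]; exists i.
exact: flip_edge.
Qed.

Lemma card_cube_edges : (#|cube_edges n|.*2 = n * 2 ^ n)%N.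
Proof.
rewrite -(sum_degree (subxx _)).
under eq_bigr do rewrite degree_cube_edges.
by rewrite sum_nat_const card_ffun card_bool card_ord mulnC.
Qed.

End CubeGeometry.

(** * Random subgraphs *)

Lemma sum_powerset_prod (R : realType) (T : finType) (A : {set T}) (a b : T -> R) :
  \sum_(E in powerset A) \prod_(e in A) (if e \in E then a e else b e) =
  \prod_(e in A) (a e + b e).
Proof.
pose a' e := if e \in A then a e else 0; pose b' e := if e \in A then b e else 1.
transitivity (\prod_e (a' e + b' e)); last first.
  rewrite [RHS]big_mkcond; apply: eq_bigr => e _; rewrite /a' /b'.
  by case: (e \in A); rewrite ?add0r.
rewrite bigA_distr [LHS]big_mkcond; apply: eq_bigr => E _.
rewrite powersetE; case: ifP => [EA|/negbT/fintype.subsetPn[e eE eA]].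
  rewrite big_mkcond; apply: eq_bigr => e _; rewrite /a' /b'.
  case: (boolP (e \in A)) => // eA; case: ifP => // eE.
  by rewrite (fintype.subsetP EA e eE) in eA.
by rewrite (bigD1 e) //= eE /a' (negbTE eA) mul0r.
Qed.

Lemma prod_subset (R : realType) (T : finType) (F : T -> R) (A S : {set T}) :
  S \subset A -> \prod_(i in A) (if i \in S then F i else 1) = \prod_(i in S) F i.
Proof.
move=> SA; rewrite [LHS]big_mkcond [RHS]big_mkcond; apply: eq_bigr => i _.
by have := fintype.subsetP SA i; case: (i \in S) => [->|] //; case: ifP.
Qed.

Section RandomSubset.
Variables (R : realType) (T : finType) (Om : {set T}) (p : R).
Hypothesis p01 : 0 <= p <= 1.
Implicit Types (E : {set T}) (P Q : pred {set T}) (f g : {set T} -> R).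

Definition weight (E : {set T}) : R :=
  \prod_(e in Om) (if e \in E then p else 1 - p).

Definition expect f : R := \sum_(E in powerset Om) weight E * f E.

Definition prob P : R := \sum_(E in powerset Om | P E) weight E.

Lemma weight_ge0 E : 0 <= weight E.
Proof.
apply: prodr_ge0 => e _; case/andP: p01 => p0 p1.
by case: ifP; rewrite ?subr_ge0.
Qed.

Lemma expect_prod (g h : T -> R) :
  expect (fun E => \prod_(e in Om) (if e \in E then g e else h e)) =
  \prod_(e in Om) (p * g e + (1 - p) * h e).
Proof.
rewrite -sum_powerset_prod; apply: eq_bigr => E _.
by rewrite /weight -big_split; apply: eq_bigr => e _; case: ifP.
Qed.

Lemma expect_sum (I : finType) (A : {set I}) (F : I -> {set T} -> R) :
  expect (fun E => \sum_(i in A) F i E) = \sum_(i in A) expect (F i).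
Proof.
rewrite /expect exchange_big; apply: eq_bigr => E _; exact: mulr_sumr.
Qed.

Lemma expectZ c f : expect (fun E => c * f E) = c * expect f.
Proof. by rewrite /expect mulr_sumr; apply: eq_bigr => E _; ring. Qed.

Lemma eq_expect f g : (forall E, E \subset Om -> f E = g E) ->
  expect f = expect g.
Proof. by move=> fg; apply: eq_bigr => E; rewrite powersetE => /fg ->. Qed.

Lemma prob_le_expect P f : (forall E, E \subset Om -> 0 <= f E) ->
  (forall E, E \subset Om -> P E -> 1 <= f E) -> prob P <= expect f.
Proof.
move=> f0 f1; rewrite /prob big_mkcondr; apply: ler_sum => E; rewrite powersetE => EO.
case: ifP => [PE|_]; last by rewrite mulr_ge0 ?weight_ge0 ?f0.
by rewrite -{1}[weight E]mulr1 ler_wpM2l ?weight_ge0 ?f1.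
Qed.

Lemma prob_ge0 P : 0 <= prob P.
Proof. by apply: sumr_ge0 => E _; exact: weight_ge0. Qed.

Lemma le_prob P Q : (forall E, E \subset Om -> P E -> Q E) -> prob P <= prob Q.
Proof.
move=> PQ; rewrite /prob big_mkcondr [leRHS]big_mkcondr; apply: ler_sum => E.
rewrite powersetE => /PQ; case: (P E); case: (Q E) => // h.
- by have := h isT.
- exact: weight_ge0.
Qed.

Lemma prob_setT : prob predT = 1.
Proof.
transitivity (expect (fun E => \prod_(e in Om) (if e \in E then 1 else 1))).
  rewrite /prob big_andbC /=; apply: eq_bigr => E _.
  by rewrite big1 ?mulr1 // => e _; case: ifP.
by rewrite expect_prod big1 // => e _; rewrite !mulr1 subrKC.
Qed.

Lemma prob_predC P : prob P = 1 - prob (predC P).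
Proof.
apply/eqP; rewrite eq_sym subr_eq -prob_setT /prob; apply/eqP.
by rewrite [LHS](bigID P) /=; congr (_ + _); apply: eq_bigl => E; rewrite andbT.
Qed.

Lemma prob_predU P Q : prob (predU P Q) <= prob P + prob Q.
Proof.
rewrite /prob big_mkcondr [X in _ <= X + _]big_mkcondr [X in _ <= _ + X]big_mkcondr.
rewrite -big_split; apply: ler_sum => E _ /=; have := weight_ge0 E.
by case: (P E); case: (Q E) => /= w; lra.
Qed.

Lemma prob_exists (I : finType) (F : I -> pred {set T}) :
  prob (fun E => [exists i, F i E]) <= \sum_i prob (F i).
Proof.
rewrite /prob big_mkcondr; under [leRHS]eq_bigr do rewrite big_mkcondr.
rewrite exchange_big; apply: ler_sum => E _ /=.
have h i : 0 <= (if F i E then weight E else 0) by case: ifP; rewrite ?weight_ge0.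
case: existsP => [[i Fi]|_]; last exact: sumr_ge0.
by rewrite (bigD1 i) //= Fi lerDl sumr_ge0.
Qed.

End RandomSubset.

Section CubeProbability.
Variables (R : realType) (n : nat) (p : R).
Hypothesis p01 : 0 <= p <= 1.
Let Om := cube_edges n.
Implicit Types (E : {set {set cube n}}) (S T : {set cube n}) (v w : cube n).

Lemma prod_degree E S (c : R) : E \subset Om ->
  \prod_(w in S) c ^+ degree E w =
  \prod_(e in Om) (if e \in E then c ^+ #|e :&: S| else 1).
Proof.
move=> EO; transitivity (\prod_(e in E) c ^+ #|e :&: S|); last first.
  rewrite [LHS]big_mkcond [RHS]big_mkcond; apply: eq_bigr => e _.
  case: (boolP (e \in E)) => [eE|_]; first by rewrite (fintype.subsetP EO e eE).
  by case: ifP.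
have cI (P : pred (cube n)) (Q : {set cube n}) :
    \prod_(w in Q) (if P w then c else 1) = c ^+ #|[set w in Q | P w]%SET|.
  rewrite -big_mkcondr /= -prodr_const; apply: eq_bigl => w.
  by rewrite inE.
have cJ w : c ^+ degree E w = \prod_(e in E) (if w \in e then c else 1).
  rewrite (degree_edges EO) -big_mkcondr -prodr_const.
  by apply: eq_bigl => e; rewrite inE.
under eq_bigr do rewrite cJ.
rewrite exchange_big; apply: eq_bigr => e _; rewrite cI; congr (_ ^+ _).
by apply: eq_card => w; rewrite !inE andbC.
Qed.

Definition monochromatic T := forall v w, v \in T -> w \in T -> parity v = parity w.

Lemma card_edge_monochromatic S e : monochromatic S -> e \in Om ->
  (#|e :&: S| <= 1)%N.
Proof.
move=> mS; rewrite inE => /existsP[x /existsP[y /andP[xy /eqP ->]]].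
apply/card_le1_eqP => v w; rewrite !inE => /andP[vxy vS] /andP[wxy wS].
have := mS _ _ vS wS; have pxy := cube_adj_parity xy.
move: vxy wxy => /orP[]/eqP -> /orP[]/eqP -> //; rewrite pxy.
  by case: parity.
by case: parity.
Qed.

(* An edge of the cube meets a monochromatic set in at most one vertex, so the
   degrees of these vertices are independent. *)
Lemma expect_prod_degree S (c : R) : monochromatic S ->
  expect Om p (fun E => \prod_(w in S) c ^+ degree E w) =
  ((1 + p * (c - 1)) ^+ n) ^+ #|S|.
Proof.
move=> mS; rewrite (@eq_expect _ _ _ p _ _ (fun E => @prod_degree E S c)) expect_prod.
set k := 1 + p * (c - 1); have -> : k ^+ n ^+ #|S| = \prod_(w in S) k ^+ degree Om w.
  by under eq_bigr do rewrite degree_cube_edges; rewrite prodr_const.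
rewrite (@prod_degree Om) //; apply: eq_bigr => e eO; rewrite eO.
have := card_edge_monochromatic mS eO.
by case: #|_| => [|[|//]] _; rewrite ?expr0 ?expr1 /k; ring.
Qed.

Lemma monochromaticS S T : S \subset T -> monochromatic T -> monochromatic S.
Proof. by move=> /fintype.subsetP ST mT v w /ST vT /ST; exact: mT. Qed.

(* Exponential Markov inequality: with [d] the degree of [w],
   [expR (a d 1_{t < d}) <= 1 + expR ((a + b) d - b t)], and the product of the
   right-hand sides expands over the subsets of [T]. *)
Lemma prob_high_degree_sum T (t X a b : R) : monochromatic T ->
  0 <= a -> 0 <= b ->
  prob Om p (fun E => X < \sum_(w in T | t < (degree E w)%:R) (degree E w)%:R) <=
  expR (- (a * X)) *
  (1 + expR (- (b * t)) * (1 + p * (expR (a + b) - 1)) ^+ n) ^+ #|T|.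
Proof.
move=> mT a0 b0; set c := expR (a + b).
pose A E w := expR (- (b * t)) * c ^+ degree E w.
have A0 E w : 0 <= A E w by rewrite mulr_ge0 ?exprn_ge0 ?expR_ge0.
pose f E := expR (- (a * X)) * \prod_(w in T) (A E w + 1).
have -> : expR (- (a * X)) *
    (1 + expR (- (b * t)) * (1 + p * (c - 1)) ^+ n) ^+ #|T| = expect Om p f.
  rewrite /f expectZ; congr (_ * _).
  under [X in expect _ _ X]funext do rewrite -sum_powerset_prod.
  rewrite expect_sum addrC -prodr_const -sum_powerset_prod.
  apply: eq_bigr => S; rewrite powersetE => ST.
  have SE := prod_subset _ ST.
  rewrite SE prodr_const exprMn -(expect_prod_degree _ (monochromaticS ST mT)) -expectZ.
  by apply: eq_expect => E _; rewrite SE /A big_split /= prodr_const.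
apply: prob_le_expect => // E _; first by
  rewrite mulr_ge0 ?expR_ge0 // prodr_ge0 // => w _; rewrite addr_ge0.
move=> hX; rewrite /f.
apply: (@le_trans _ _ (expR (- (a * X)) *
    expR (a * \sum_(w in T | t < (degree E w)%:R) (degree E w)%:R))).
  rewrite -expRD -[leLHS]expR0 ler_expR addrC subr_ge0 ler_wpM2l //; exact: ltW.
rewrite ler_wpM2l ?expR_ge0 // mulr_sumr expR_sum big_mkcondr.
apply: ler_prod => w _; case: ifP => tw.
  rewrite expR_ge0 /= ler_wpDr // /A /c -expRM_natr -expRD ler_expR.
  rewrite mulrDl; have : b * t <= b * (degree E w)%:R by rewrite ler_wpM2l // ltW.
  by lra.
by rewrite ler01 /= lerDr.
Qed.

Lemma monochromatic_ball1 v : monochromatic (ball1 v).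
Proof. by move=> u w /ball1_parity -> /ball1_parity ->. Qed.

Lemma monochromatic_ball2 v : monochromatic (ball2 v).
Proof. by move=> u w /ball2_parity -> /ball2_parity ->. Qed.

Lemma card_parity_class : exists b : bool,
  (2 ^ n <= 2 * #|[set v : cube n | parity v == b]%SET|)%N.
Proof.
pose T b := [set v : cube n | parity v == b]%SET.
have h : (#|T true| + #|T false| = 2 ^ n)%N.
  rewrite -[in RHS](card_ord n) -card_bool -card_ffun -(cardsC (T true)).
  by congr (_ + _)%N; apply: eq_card => v; rewrite !inE; case: parity.
have [le|lt] := leqP #|T false| #|T true|; [exists true|exists false];
  rewrite -/(T _) -h; lia.
Qed.

Section FirstEdges.
Variable k : nat.
Hypothesis kn : (k <= n)%N.

Definition first_edges v : {set {set cube n}} :=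
  [set [set v; flip v i]%SET | i : 'I_n & (i < k)%N]%SET.

Lemma flip_neq v i : flip v i != v.
Proof. by apply/eqP => /ffunP/(_ i); rewrite ffunE eqxx; case: (v i). Qed.

Lemma edge_inj v i j : [set v; flip v i]%SET = [set v; flip v j]%SET -> i = j.
Proof.
move=> e; apply: (@flip_inj n v); have : flip v i \in [set v; flip v j]%SET.
  by rewrite -e set22.
by rewrite !inE (negbTE (flip_neq v i)) => /eqP.
Qed.

Lemma card_first_edges v : #|first_edges v| = k.
Proof.
rewrite card_in_imset; last by move=> i j _ _; exact: edge_inj.
have wi : injective (widen_ord kn) by move=> i j /(congr1 val) h; apply/val_inj.
rewrite -[RHS]card_ord -(card_imset _ wi).
apply: eq_card => i; rewrite inE; apply/idP/imsetP => [ik|[j _ ->]]; last first.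
  exact: (ltn_ord j).
by exists (Ordinal ik) => //; apply/val_inj.
Qed.

Lemma first_edges_sub v : first_edges v \subset Om.
Proof. by apply/fintype.subsetP => _ /imsetP[i _ ->]; exact: flip_edge. Qed.

Lemma first_edges_degree E v : first_edges v \subset E -> (k <= degree E v)%N.
Proof.
move=> /fintype.subsetP fE; rewrite -(card_first_edges v).
rewrite card_in_imset; last by move=> i j _ _; exact: edge_inj.
rewrite -(card_imset _ (@flip_inj n v)); apply: subset_leq_card.
apply/fintype.subsetP => _ /imsetP[i ik ->]; rewrite inE; apply: fE.
by apply/imsetP; exists i.
Qed.

Lemma first_edges_disjoint v w e : parity v = parity w ->
  e \in first_edges v -> e \in first_edges w -> v = w.
Proof.
move=> vw /imsetP[i _ ->] /imsetP[j _ e'].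
have : v \in [set w; flip w j]%SET by rewrite -e' set21.
rewrite !inE => /orP[/eqP //|/eqP vf]; move: vw; rewrite vf parity_flip.
by case: parity.
Qed.

(* The events [first_edges v \subset E], for [v] in a parity class, are
   independent of probability [p ^+ k]; expanding [prod_v (1 - I E v)] is
   inclusion-exclusion. *)
Lemma prob_max_degree_lt : prob Om p (fun E => (max_degree E < k)%N) <=
  expR (- (p ^+ k * (2 ^+ n / 2))).
Proof.
have [b hb] := card_parity_class; set T := [set v | _]%SET in hb.
have mT : monochromatic T by move=> v w; rewrite !inE => /eqP -> /eqP ->.
pose I E v : R := \prod_(e in Om) (if e \in E then 1 else (e \notin first_edges v)%:R).
have IE E v : E \subset Om -> I E v = (first_edges v \subset E)%:R.
  move=> EO; have [/fintype.subsetP fE|/fintype.subsetPn[e ef eE]] := boolP (_ \subset _).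
    rewrite /I big1 // => e _; case: (boolP (e \in E)) => // eE.
    by case: (boolP (e \in first_edges v)) => // /fE; rewrite (negbTE eE).
  by rewrite /I (bigD1 e) ?(fintype.subsetP (first_edges_sub v)) //= (negbTE eE) ef mul0r.
pose f E := \prod_(v in T) (- I E v + 1).
have Ef : expect Om p f = (1 - p ^+ k) ^+ #|T|.
  rewrite /f; under [X in expect _ _ X]funext do rewrite -sum_powerset_prod.
  rewrite expect_sum -prodr_const addrC -sum_powerset_prod.
  apply: eq_bigr => S; rewrite powersetE => ST.
  have SE := prod_subset _ ST.
  rewrite SE; under [X in expect _ _ X]funext do
    (rewrite SE prodrN; under eq_bigr do rewrite /I).
  rewrite expectZ prodrN; congr (_ * _).
  rewrite (@eq_expect _ _ _ p _ (fun E => \prod_(e in Om)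
     (if e \in E then 1 else \prod_(v in S) (e \notin first_edges v)%:R))); last first.
    move=> E _; rewrite exchange_big; apply: eq_bigr => e _.
    by case: ifP => // _; rewrite big1.
  rewrite expect_prod.
  have -> : \prod_(v in S) p ^+ k =
      \prod_(v in S) \prod_(e in Om) (if e \in first_edges v then p else 1).
    apply: eq_bigr => v _; rewrite -[in LHS](card_first_edges v) -prodr_const.
    by rewrite prod_subset // first_edges_sub.
  rewrite [RHS]exchange_big; apply: eq_bigr => e _.
  have [/existsP[v /andP[vS ev]]|h] :=
      boolP [exists v, (v \in S) && (e \in first_edges v)].
    rewrite (bigD1 v) //= [X in _ = X](bigD1 v) //= ev mul0r mulr0 addr0 big1 // => w.
    move=> /andP[wS wv]; case: ifP => // ew; move: wv.
    rewrite (@first_edges_disjoint w v e) ?eqxx //.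
    by apply: (monochromaticS ST mT).
  rewrite !big1 ?mulr1 ?subrKC // => v vS; first by
    rewrite ifN //; apply: contraNN h => ev; apply/existsP; exists v; rewrite vS.
  rewrite (_ : e \notin _ = true) //; apply: contraNN h => ev.
  by apply/existsP; exists v; rewrite vS.
have pk : 0 <= 1 - p ^+ k by case/andP: p01 => p0 p1; rewrite subr_ge0 exprn_ile1.
apply: (@le_trans _ _ (expect Om p f)).
  apply: prob_le_expect => // E EO.
    apply: prodr_ge0 => v _; rewrite IE // addrC subr_ge0.
    by case: (_ \subset _).
  move=> mk; rewrite /f big1 // => v _; rewrite IE //.
  case: (boolP (_ \subset _)) => [/first_edges_degree kd|_]; last by rewrite oppr0 add0r.
  by have := leq_ltn_trans (leq_trans kd (leq_bigmax v)) mk; rewrite ltnn.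
rewrite Ef; apply: (@le_trans _ _ (expR (- p ^+ k) ^+ #|T|)).
  by apply: lerXn2r; rewrite ?nnegrE ?expR_ge0 // expR_ge1Dx.
rewrite -expRM_natr ler_expR mulNr lerN2; apply: ler_wpM2l.
  by case/andP: p01 => p0 p1; rewrite exprn_ge0.
by rewrite ler_pdivrMr // mulrC -natrX -natrM ler_nat.
Qed.

End FirstEdges.

Lemma prob_few_edges (a : R) : 0 <= a ->
  prob Om p (fun E => #|E|%:R < (1 - 2 * a) * (p * #|Om|%:R)) <=
  expR (- (a ^+ 2 * (p * #|Om|%:R))).
Proof.
move=> a0; set N : R := #|Om|%:R; set th := (1 - 2 * a) * (p * N).
case/andP: (p01) => p0 p1.
pose f E := expR (a * th) * \prod_(e in Om) (if e \in E then expR (- a) else 1).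
have fE E : E \subset Om -> f E = expR (a * th - a * #|E|%:R).
  move=> EO; rewrite /f expRD; congr (_ * _).
  by rewrite -mulNr expRM_natr -prodr_const prod_subset.
apply: (@le_trans _ _ (expect Om p f)).
  apply: prob_le_expect => // E EO; rewrite fE ?expR_ge0 // => hE.
  by rewrite -[leLHS]expR0 ler_expR subr_ge0 ler_wpM2l // ltW.
rewrite expectZ expect_prod prodr_const mulr1.
have ea : expR (- a) <= 1 - a + a ^+ 2.
  have h : 1 + a <= expR a := expR_ge1Dx a.
  rewrite expRN -[leLHS]mul1r ler_pdivrMr ?expR_gt0 //.
  apply: le_trans (ler_wpM2l _ h); nra.
have le1 : 0 <= p * expR (- a) + (1 - p) <= expR (- (p * (a - a ^+ 2))).
  rewrite addr_ge0 ?subr_ge0 ?mulr_ge0 ?expR_ge0 //=.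
  apply: le_trans (expR_ge1Dx _); nra.
apply: (@le_trans _ _ (expR (a * th) * expR (- (p * (a - a ^+ 2))) ^+ #|Om|)).
  rewrite ler_wpM2l ?expR_ge0 //.
  by case/andP: le1 => ? ?; apply: lerXn2r; rewrite ?nnegrE ?expR_ge0.
rewrite -expRM_natr -expRD ler_expR /th -/N le_eqVlt; apply/orP; left; apply/eqP.
ring.
Qed.

End CubeProbability.

(** * Numerical estimates and likely events *)

Section Numerics.
Variable R : realType.
Implicit Types (c x w M : R) (n k : nat).

Definition error_rate c x : R := c / x `^ 20^-1.

Lemma error_rate_ge c w M : 0 <= c -> 0 < w -> 0 < M -> M <= w ^+ 20 ->
  c / w <= error_rate c M.
Proof.
move=> c0 w0 M0 Mw; rewrite /error_rate ler_wpM2l // lef_pV2 ?posrE ?powR_gt0 //.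
have -> : w = (w ^+ 20) `^ 20^-1.
  by rewrite -powR_mulrn ?(ltW w0) // -powRrM divff ?powRr1 ?(ltW w0).
by apply: ge0_ler_powR; rewrite ?nnegrE ?invr_ge0 ?ler0n // ?ltW // exprn_gt0.
Qed.

Lemma expR_ge_pow x k : 0 <= x -> (x / k.+1%:R) ^+ k.+1 <= expR x.
Proof.
move=> x0; have -> : expR x = expR (x / k.+1%:R) ^+ k.+1.
  by rewrite -expRM_natr divfK // pnatr_eq0.
apply: lerXn2r; rewrite ?nnegrE ?expR_ge0 ?divr_ge0 ?ler0n //.
by apply: le_trans (expR_ge1Dx _); rewrite lerDr.
Qed.

Lemma expR_half_le2 : expR (2^-1) <= 2 :> R.
Proof.
have h : 1 + - 2^-1 <= expR (- 2^-1) :> R := expR_ge1Dx _.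
rewrite expRN in h; have e0 : 0 < expR (2^-1) :> R := expR_gt0 _.
have := ler_wpM2r (ltW e0) h; rewrite mulVf ?gt_eqF //; lra.
Qed.

Lemma pow2_ge_expR n : expR (n%:R / 2) <= 2 ^+ n :> R.
Proof.
rewrite mulrC expRM_natr; apply: lerXn2r; rewrite ?nnegrE ?expR_ge0 //.
exact: expR_half_le2.
Qed.

Lemma pow2_le_expR n : 2 ^+ n <= expR n%:R :> R.
Proof.
rewrite -[n%:R]mul1r expRM_natr; apply: lerXn2r; rewrite ?nnegrE ?expR_ge0 //.
by apply: le_trans (expR_ge1Dx _); lra.
Qed.

Lemma bernoulli_le_expR x n : 0 <= 1 + x -> (1 + x) ^+ n <= expR (n%:R * x).
Proof.
move=> x0; rewrite mulrC expRM_natr; apply: lerXn2r; rewrite ?nnegrE ?expR_ge0 //.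
exact: expR_ge1Dx.
Qed.

Lemma expR_le_quadratic x : 0 <= x <= 2^-1 -> expR x <= 1 + x + 2 * x ^+ 2.
Proof.
move=> /andP[x0 x1]; have h : 1 + - x <= expR (- x) := expR_ge1Dx _.
rewrite expRN in h; have e0 : 0 < expR x := expR_gt0 _.
have := ler_wpM2r (ltW e0) h; rewrite mulVf ?gt_eqF // => h1.
have h2 : 0 < 1 - x by lra.
rewrite -(ler_pM2l h2); apply: le_trans h1 _; nra.
Qed.

End Numerics.

Section Events.
Variables (R : realType) (n : nat) (p : R).
Hypothesis p01 : 0 <= p <= 1.
Let Om := cube_edges n.

(* Some vertex sees, at distance one or among the endpoints of walks of length
   two, vertices of degree above [t] whose degrees sum to more than [X]. *)
Definition high_cluster (t X : R) (E : {set {set cube n}}) : bool :=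
  [exists v, X < \sum_(w in ball1 v | t < (degree E w)%:R) (degree E w)%:R] ||
  [exists v, X < \sum_(w in ball2 v | t < (degree E w)%:R) (degree E w)%:R].

Lemma high_clusterPn t X E : ~~ high_cluster t X E ->
  (forall v, \sum_(w in ball1 v | t < (degree E w)%:R) (degree E w)%:R <= X) /\
  (forall v, \sum_(w in ball2 v | t < (degree E w)%:R) (degree E w)%:R <= X).
Proof.
by rewrite negb_or => /andP[/existsPn h1 /existsPn h2]; split=> v; rewrite leNgt.
Qed.

Lemma high_clusterW t t' X E : t <= t' ->
  high_cluster t' X E -> high_cluster t X E.
Proof.
move=> tt'; have le (A : {set cube n}) :
    \sum_(w in A | t' < (degree E w)%:R) (degree E w)%:R <=
    \sum_(w in A | t < (degree E w)%:R) (degree E w)%:R :> R.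
  rewrite big_mkcondr [leRHS]big_mkcondr; apply: ler_sum => u _.
  by case: ifP => [/(le_lt_trans tt') ->|_] //; case: ifP.
by move=> /orP[] /existsP[v hv]; apply/orP; [left|right]; apply/existsP; exists v;
  exact: lt_le_trans (le _).
Qed.

Lemma prob_high_cluster (t X a b : R) : (0 < n)%N -> 0 <= a -> 0 <= b ->
  2 * n%:R <= a * X ->
  n%:R ^+ 2 * expR (n%:R * (p * (expR (a + b) - 1)) - b * t) <= 1 ->
  prob Om p (high_cluster t X) <= 2 * expR (1 - n%:R).
Proof.
move=> n0 a0 b0 aX hrho.
set rho := expR (- (b * t)) * (1 + p * (expR (a + b) - 1)) ^+ n.
case/andP: (p01) => p0 p1.
have eab : 0 <= expR (a + b) - 1.
  by rewrite subr_ge0 -[leLHS]expR0 ler_expR addr_ge0.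
have rho0 : 0 <= rho.
  by rewrite mulr_ge0 ?expR_ge0 // exprn_ge0 // addr_ge0 // mulr_ge0.
have rho1 : n%:R ^+ 2 * rho <= 1.
  apply: le_trans hrho; rewrite ler_wpM2l ?exprn_ge0 //.
  rewrite [X in _ <= expR X]addrC [leRHS]expRD; apply: ler_wpM2l (expR_ge0 _) _ _ _.
  by apply: bernoulli_le_expR; rewrite addr_ge0 // mulr_ge0.
have one (T : {set cube n}) : monochromatic T -> (#|T| <= n ^ 2)%N ->
    prob Om p (fun E => X < \sum_(w in T | t < (degree E w)%:R) (degree E w)%:R)
    <= expR (1 - 2 * n%:R).
  move=> mT cT; apply: le_trans (prob_high_degree_sum p01 t X mT a0 b0) _.
  rewrite -/rho mulrC [leRHS]expRD; apply: ler_pM; rewrite ?expR_ge0 ?exprn_ge0 //.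
  - by rewrite addr_ge0.
  - apply: le_trans (bernoulli_le_expR _ _) _; first by rewrite addr_ge0.
    rewrite ler_expR; apply: le_trans rho1; rewrite ler_wpM2r //.
    by rewrite -natrX ler_nat.
  - by rewrite ler_expR lerN2.
have cV : #|cube n| = (2 ^ n)%N by rewrite card_ffun card_bool card_ord.
have all (B : cube n -> {set cube n}) : (forall v, monochromatic (B v)) ->
    (forall v, #|B v| <= n ^ 2)%N ->
    prob Om p (fun E => [exists v,
      X < \sum_(w in B v | t < (degree E w)%:R) (degree E w)%:R])
    <= expR (1 - n%:R).
  move=> mB cB; apply: le_trans (prob_exists _ p01 _) _.
  apply: (@le_trans _ _ (\sum_(v : cube n) expR (1 - 2 * n%:R))).
    by apply: ler_sum => v _; exact: one.
  rewrite sumr_const cV -[leLHS]mulr_natl natrX.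
  apply: (@le_trans _ _ (expR n%:R * expR (1 - 2 * n%:R))).
    by rewrite ler_wpM2r ?expR_ge0 // pow2_le_expR.
  by rewrite -expRD ler_expR; lra.
apply: le_trans (prob_predU _ p01 _ _) _.
rewrite mulr2n mulrDl !mul1r; apply: lerD; apply: all => v.
- exact: monochromatic_ball1.
- by apply: leq_trans (card_ball1 v) _; rewrite -mulnn leq_pmulr.
- exact: monochromatic_ball2.
- exact: card_ball2.
Qed.

Lemma prob_small_max_degree k : (k <= n)%N -> n%:R <= p ^+ k * (2 ^+ n / 2) ->
  prob Om p (fun E => (max_degree E < k)%N) <= expR (1 - n%:R).
Proof.
move=> kn h; apply: le_trans (prob_max_degree_lt p01 kn) _.
by rewrite ler_expR; lra.
Qed.

Lemma card_cube_edgesR : 2 * #|Om|%:R = n%:R * 2 ^+ n :> R.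
Proof. by rewrite -natrX -!natrM -card_cube_edges -mul2n. Qed.

Lemma prob_few_edges_dense : 1 <= n%:R * p -> 2 * n%:R ^+ 3 <= 2 ^+ n :> R ->
  prob Om p (fun E => #|E|%:R < (1 - 2 / n%:R) * (p * #|Om|%:R)) <=
  expR (1 - n%:R).
Proof.
move=> np hn; have n0 : 0 < n%:R :> R.
  by rewrite ltr0n lt0n; apply: contraTneq np => ->; rewrite mul0r ler10.
have a0 : 0 <= n%:R^-1 :> R by rewrite invr_ge0 ltW.
apply: le_trans (prob_few_edges n p01 a0) _; rewrite ler_expR.
suff : n%:R <= n%:R^-1 ^+ 2 * (p * #|Om|%:R) by lra.
have e : p * #|Om|%:R = (n%:R * p) * 2 ^+ n / 2.
  by have := card_cube_edgesR => /(congr1 (fun z => p * z)); lra.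
rewrite e -(@ler_pM2l _ (n%:R ^+ 2)) ?exprn_gt0 // exprVn mulVKf ?gt_eqF ?exprn_gt0 //.
have : 1 * 2 ^+ n <= n%:R * p * 2 ^+ n :> R by rewrite ler_wpM2r // exprn_ge0.
by move: hn; rewrite exprS; lra.
Qed.

End Events.

(** * Deterministic estimates of the largest eigenvalue *)

Section Regimes.
Variables (R : realType) (n : nat) (p : R) (E : {set {set cube n}}).
Hypothesis p0 : 0 <= p.
Hypothesis subE : E \subset cube_edges n.

Let Delta : R := (max_degree E)%:R.
Let M : R := Num.max (Num.sqrt Delta) (n%:R * p).
Let lam := lambda1 R E.

Definition lambda1_close (c : R) : bool := `|lam - M| <= error_rate c M * M.

Lemma lambda1_closeI c w : 0 <= c -> 0 < w -> 0 < M -> M <= w ^+ 20 ->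
  `|lam - M| <= c / w * M -> lambda1_close c.
Proof.
move=> c0 w0 M0 Mw h; apply: le_trans h _; rewrite ler_wpM2r ?(ltW M0) //.
exact: error_rate_ge.
Qed.

Let Delta0 : 0 <= Delta. Proof. exact: ler0n. Qed.

Lemma degree_le_of_no_cluster t X : (0 < n)%N -> 0 <= X ->
  ~~ high_cluster t X E -> Delta <= Num.max t X.
Proof.
move=> n0 X0 /high_clusterPn[_ h2].
have [v dv] : {v | max_degree E = degree E v}.
  by apply: bigop.eq_bigmax; rewrite card_ffun card_bool card_ord expn_gt0.
rewrite le_max /Delta dv; have [//|tv] := lerP (degree E v)%:R t.
apply: le_trans (h2 v).
have vv : v \in ball2 v.
  pose i := Ordinal n0; apply: (@mem_ball2 _ v (flip v i)).
    by apply/cube_adjP; exists i.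
  by rewrite cube_adjC; apply/cube_adjP; exists i.
rewrite (bigD1 v) ?vv //= lerDl; apply: sumr_ge0 => w _; exact: ler0n.
Qed.

Lemma lambda1_close_bounded c K : 1 <= K -> K ^+ 2 <= c -> Delta <= K ^+ 2 ->
  n%:R * p <= 1 -> lambda1_close c.
Proof.
move=> K1 Kc D1 np1; have np0 : 0 <= n%:R * p by rewrite mulr_ge0.
have K0 : 0 < K by lra.
have KK : K <= K ^+ 2 by rewrite ler_eXnr.
have c0 : 0 <= c by lra.
have lD : lam <= Delta := lambda1_le_max_degree E R.
have sl : Num.sqrt Delta <= lam := sqrt_max_degree_le_lambda1 subE R.
have [D0|Dpos] := posnP (max_degree E).
  have DE : Delta = 0 by rewrite /Delta D0.
  have l0 : lam = 0 by apply/eqP; rewrite eq_le; move: sl lD; rewrite DE sqrtr0 => -> ->.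
  have ME : M = n%:R * p by rewrite /M DE sqrtr0; apply/max_idPr.
  move: np0; rewrite le_eqVlt => /orP[/eqP z|np0].
    by rewrite /lambda1_close ME l0 -z subr0 normr0 mulr0.
  apply: (@lambda1_closeI c 1); rewrite ?ltr01 ?ME ?expr1n //.
  by rewrite l0 sub0r normrN gtr0_norm // divr1 ler_peMl ?(ltW np0) //; lra.
have D1' : 1 <= Delta by rewrite ler1n.
have sD1 : 1 <= Num.sqrt Delta by rewrite -sqrtr1 ler_sqrt.
have ME : M = Num.sqrt Delta by apply/max_idPl; lra.
have MM : M * M = Delta by rewrite ME -expr2 sqr_sqrtr.
have M1 : 1 <= M by rewrite ME.
have MK : M <= K.
  have : M ^+ 2 <= K ^+ 2 by rewrite [M ^+ 2]expr2 MM.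
  by rewrite ler_pXn2r // nnegrE; lra.
apply: (@lambda1_closeI c K) => //; first lra.
  by apply: le_trans MK _; exact: ler_eXnr.
have KM : K * M <= c / K * M.
  by rewrite ler_wpM2r ?ler_pdivlMr -?expr2 //; lra.
have : M * M <= K * M by rewrite ler_wpM2r //; lra.
have : 0 <= K * M by rewrite mulr_ge0 //; lra.
by rewrite ler_norml; move: sl lD; rewrite -ME -MM => ? ? ? ?; apply/andP; split; lra.
Qed.

Lemma lambda1_close_sparse c b : 511 <= c -> 2 <= b -> 8 <= b ^+ 2 ->
  n%:R * p <= 1 -> 1 <= Delta -> Delta <= b ^+ 8 -> b ^+ 8 <= 48 * Delta ->
  ~~ high_cluster (b ^+ 2) (b ^+ 8) E -> lambda1_close c.
Proof.
move=> c1 b2 bb np1 D1 DX XD /high_clusterPn[h1 h2].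
have b0 : 0 < b by lra.
have pk k : 0 < b ^+ k by rewrite exprn_gt0.
have bS k : b ^+ k <= b ^+ k.+1 by rewrite ler_eXn2l //; lra.
have sl : Num.sqrt Delta <= lam := sqrt_max_degree_le_lambda1 subE R.
have sD1 : 1 <= Num.sqrt Delta by rewrite -sqrtr1 ler_sqrt.
have ME : M = Num.sqrt Delta by apply/max_idPl; lra.
have MM : M ^+ 2 = Delta by rewrite ME sqr_sqrtr.
have M1 : 1 <= M by rewrite ME.
have b4M : b ^+ 4 <= 7 * M.
  have : (b ^+ 4) ^+ 2 <= (7 * M) ^+ 2 by rewrite [leRHS]exprMn MM -exprM; lra.
  by rewrite ler_pXn2r // nnegrE ?ltW //; lra.
have Mb4 : M <= b ^+ 4.
  have : M ^+ 2 <= (b ^+ 4) ^+ 2 by rewrite MM -exprM.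
  by rewrite ler_pXn2r // nnegrE ?ltW //; lra.
have ub : lam <= (M + b ^+ 3) + 4 * (2 * b ^+ 6 / (M + b ^+ 3)) +
    4 * (2 * b ^+ 3 + 2 * b ^+ 3).
  have m0 : 0 < M + b ^+ 3 by rewrite addr_gt0 //; lra.
  have Xs : b ^+ 8 / b ^+ 6 = b ^+ 2 by rewrite -expfB.
  have Xt : b ^+ 8 / b ^+ 2 = b ^+ 6 by rewrite -expfB.
  apply: (@lambda1_le_of_sparse_high n E subE R (b ^+ 2) (b ^+ 8) (b ^+ 6)) => //.
  - by rewrite mulr_ge0 // ltW.
  - by rewrite mulr_ge0 // ltW.
  - by rewrite mulr_ge0 // ltW.
  - by have := bS 2%N; lra.
  - rewrite Xs -/Delta -MM sqrrD -exprM.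
    have e6 : b ^+ 6 = b ^+ 2 * b ^+ 2 * b ^+ 2 by rewrite -!exprD.
    have : 64 * b ^+ 2 <= b ^+ 6.
      by rewrite e6 ler_wpM2r ?(ltW (pk _)) //; have := ler_pM _ _ bb bb; lra.
    have : 0 <= M * b ^+ 3 by rewrite mulr_ge0 ?(ltW (pk _)) //; lra.
    by have := pk 2%N; lra.
  - rewrite Xs exprMn -exprM -/Delta.
    have : Delta * (2 * b ^+ 4) <= b ^+ 8 * (2 * b ^+ 4).
      by rewrite ler_wpM2r // mulr_ge0 // ltW.
    rewrite (_ : b ^+ 8 * (2 * b ^+ 4) = 2 * b ^+ 12); last by ring.
    rewrite (_ : Delta * b ^+ 2 * (2 * b ^+ 2) = Delta * (2 * b ^+ 4)); last by ring.
    by have := pk 12%N; lra.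
  - by rewrite Xt exprMn -exprM; have := pk 6%N; lra.
  - by rewrite Xt exprMn -exprM; have := pk 6%N; lra.
apply: (@lambda1_closeI c b) => //; [lra|lra| |].
  by apply: le_trans Mb4 _; rewrite ler_eXn2l //; lra.
have cb : 511 / b * M <= c / b * M.
  by rewrite ler_wpM2r ?ler_wpM2r ?invr_ge0 ?(ltW b0) //; lra.
have b3 : b ^+ 3 <= 7 * (M / b).
  by rewrite mulrA ler_pdivlMr // -exprSr.
have e14 : 2 * b ^+ 6 / (M + b ^+ 3) <= 14 * b ^+ 2.
  rewrite ler_pdivrMr ?addr_gt0 //; last lra.
  have : 2 * b ^+ 2 * b ^+ 4 <= 2 * b ^+ 2 * (7 * (M + b ^+ 3)).
    by rewrite ler_wpM2l ?mulr_ge0 ?(ltW (pk _)) //; have := pk 3%N; lra.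
  rewrite (_ : 2 * b ^+ 2 * b ^+ 4 = 2 * b ^+ 6); last by ring.
  lra.
rewrite ler_norml; apply/andP; split.
  have : 0 <= c / b * M by rewrite !mulr_ge0 ?invr_ge0 ?(ltW b0) //; lra.
  by move: sl; rewrite -ME; lra.
have -> : c / b * M = c * (M / b) by ring.
have : 511 * (M / b) <= c * (M / b) by rewrite ler_wpM2r ?divr_ge0 ?(ltW b0) //; lra.
by have := bS 2%N; lra.
Qed.

Lemma lambda1_close_dense c w : 241 <= c -> 256 <= w -> w ^+ 20 = n%:R ->
  p <= 1 -> w ^+ 18 <= Delta ->
  ~~ high_cluster ((1 + w^-1) * Num.max (n%:R * p) (w ^+ 9)) (128 * w ^+ 22) E ->
  (1 <= n%:R * p ->
   (1 - 2 / n%:R) * (p * #|cube_edges n|%:R) <= #|E|%:R) ->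
  lambda1_close c.
Proof.
move=> c1 w1 wn p1 wD /high_clusterPn[h1 h2] hE.
have w0 : 0 < w by lra.
set v := w^-1 in h1 h2 *; have v0 : 0 < v by rewrite invr_gt0.
have vw : v * w = 1 by rewrite mulVf // gt_eqF.
have pk k : 0 < w ^+ k by rewrite exprn_gt0.
have vS k : v * w ^+ k.+1 = w ^+ k by rewrite exprS mulrA vw mul1r.
have wle j k : (j <= k)%N -> w ^+ j <= w ^+ k.
  by move=> jk; rewrite ler_eXn2l //; lra.
have v1 : v <= 1 by rewrite invf_le1 //; lra.
have sl : Num.sqrt Delta <= lam := sqrt_max_degree_le_lambda1 subE R.
have sM : Num.sqrt Delta <= M by rewrite le_max lexx.
have dM : n%:R * p <= M by rewrite le_max lexx orbT.
have w9 : w ^+ 9 <= Num.sqrt Delta.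
  by rewrite -[leLHS]ger0_norm ?(ltW (pk _)) // -sqrtr_sqr ler_sqrt -?exprM.
have wM : w ^+ 9 <= M by apply: le_trans sM.
have M0 : 0 < M by apply: lt_le_trans wM.
have DM : Delta <= M ^+ 2.
  by rewrite -[leLHS]sqr_sqrtr // ler_pXn2r ?nnegrE ?sqrtr_ge0 // ltW.
set mu := Num.max _ _ in h1 h2; set t := (1 + v) * mu in h1 h2.
have muM : mu <= M by rewrite ge_max dM wM.
have w9mu : w ^+ 9 <= mu by rewrite le_max lexx orbT.
have w9t : w ^+ 9 <= t.
  apply: (le_trans w9mu); rewrite ler_peMl //; last lra.
  exact: le_trans (ltW (pk _)) w9mu.
have t0 : 0 < t by apply: lt_le_trans w9t.
pose m := (1 + v) * M.
have tm : t <= m by rewrite /t /m ler_wpM2l //; lra.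
have Mm : M <= m by rewrite /m ler_peMl ?(ltW M0) //; lra.
have m2M : m <= 2 * M by rewrite /m ler_wpM2r ?(ltW M0) //; lra.
have m0 : 0 < m by apply: lt_le_trans Mm.
have Xs : 128 * w ^+ 22 / w ^+ 16 = 128 * w ^+ 6 by rewrite -mulrA -expfB.
have Xt : 128 * w ^+ 22 / t <= 128 * w ^+ 13.
  have e : 128 * w ^+ 22 = 128 * w ^+ 13 * w ^+ 9 by rewrite -mulrA -exprD.
  rewrite ler_pdivrMr // e; apply: ler_wpM2l w9t.
  by apply: mulr_ge0; [exact: ler0n|exact: ltW].
have vM2 : w ^+ 17 <= v * M ^+ 2.
  rewrite -vS ler_wpM2l ?(ltW v0) //; exact: le_trans DM.
have ub : lam <= m + 4 * (23 * (v * M ^+ 2) / m) + 4 * (20 * w ^+ 8 + 17 * w ^+ 8).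
  apply: (@lambda1_le_of_sparse_high n E subE R t (128 * w ^+ 22) (w ^+ 16)) => //.
  - by rewrite !mulr_ge0 ?exprn_ge0 ?(ltW M0) ?(ltW v0).
  - by rewrite mulr_ge0 // ltW.
  - by rewrite mulr_ge0 // ltW.
  - rewrite Xs -/Delta.
    clear tm m2M Mm m0 Xt w9t w9mu muM w9 wM sl sM dM wn c1 p1.
    have : 128 * w ^+ 6 <= w ^+ 17.
      apply: le_trans (wle 7%N 17%N isT); rewrite (exprS w 6) ler_wpM2r ?(ltW (pk _)) //.
      lra.
    have -> : m ^+ 2 = M ^+ 2 + 2 * (v * M ^+ 2) + v ^+ 2 * M ^+ 2 by rewrite /m; ring.
    have : 0 <= v ^+ 2 * M ^+ 2 by rewrite mulr_ge0 ?sqr_ge0.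
    lra.
  - rewrite Xs -/Delta; clear Xs Xt vM2 w9t w9mu muM w9 sl sM dM wn c1 p1 wD.
    have a1 : Delta * t <= M ^+ 2 * (2 * M).
      by apply: ler_pM; rewrite ?(ltW t0) //; lra.
    have a2 : Delta * t * (2 * (128 * w ^+ 6)) <= M ^+ 2 * (2 * M) * (2 * (128 * w ^+ 6)).
      by apply: (ler_wpM2r _ a1); have := pk 6%N; lra.
    have a3 : M ^+ 3 * w ^+ 6 <= M ^+ 3 * (v ^+ 2 * M).
      rewrite ler_wpM2l ?exprn_ge0 ?(ltW M0) //.
      apply: le_trans (wle 6%N 7%N isT) _; rewrite -vS -vS mulrA -expr2.
      by rewrite ler_wpM2l ?sqr_ge0.
    have -> : (23 * (v * M ^+ 2)) ^+ 2 = 529 * (M ^+ 3 * (v ^+ 2 * M)) by ring.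
    have : 0 <= M ^+ 3 * w ^+ 6 by rewrite mulr_ge0 ?exprn_ge0 ?(ltW M0) ?(ltW w0).
    have e : M ^+ 2 * (2 * M) * (2 * (128 * w ^+ 6)) = 512 * (M ^+ 3 * w ^+ 6) by ring.
    lra.
  - clear tm m2M Mm w9t w9mu muM w9 wM sl sM dM wn c1 p1 vM2; rewrite exprMn -exprM.
    have := wle 13%N 16%N isT; have := pk 13%N; lra.
  - clear tm m2M Mm w9t w9mu muM w9 wM sl sM dM wn c1 p1 vM2; rewrite exprMn -exprM.
    have := wle 13%N 16%N isT; have := pk 13%N; lra.
have vM0 : 0 < v * M by rewrite mulr_gt0.
clear muM w9mu w9t t0 tm m2M Xs Xt vM2 DM h1 h2 wD v1.
apply: (@lambda1_closeI c w) => //; first lra.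
  rewrite wn ge_max ler_piMr ?ler0n // andbT.
  rewrite -[leRHS]ger0_norm ?ler0n // -sqrtr_sqr ler_sqrt ?sqr_ge0 //.
  rewrite -natrX ler_nat; apply: leq_trans (max_degree_le subE) _.
  by rewrite -mulnn; case: (n) => // k; rewrite leq_pmulr.
have -> : c / w * M = c * (v * M) by rewrite /v mulrA.
have cv : 241 * (v * M) <= c * (v * M) by rewrite ler_wpM2r // ltW.
have w8 : w ^+ 8 <= v * M by rewrite -vS ler_wpM2l // ltW.
have em : 23 * (v * M ^+ 2) / m <= 23 * (v * M).
  rewrite ler_pdivrMr // expr2 -!mulrA !ler_wpM2l // ?(ltW v0) ?(ltW M0) //.
have mE : m = M + v * M by rewrite /m; ring.
rewrite ler_norml; apply/andP; split; last by lra.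
have [npD|Dnp] := leP (n%:R * p) (Num.sqrt Delta).
  have ME : M = Num.sqrt Delta by apply/max_idPl.
  by move: sl; rewrite -ME; lra.
have ME : M = n%:R * p by apply/max_idPr/ltW.
have np1 : 1 <= n%:R * p.
  apply: le_trans (ltW Dnp); apply: le_trans w9.
  by rewrite -[leLHS](expr0 w); exact: wle.
have n0 : 0 < n%:R :> R by rewrite -wn.
have nv : n%:R^-1 <= v.
  by rewrite /v lef_pV2 ?posrE // -wn -[leLHS]expr1; exact: wle.
have : (1 - 2 / n%:R) * (n%:R * p) * 2 ^+ n <= lam * 2 ^+ n.
  apply: le_trans (card_edges_le_lambda1 subE R); rewrite -mul2n natrM.
  apply: le_trans (ler_wpM2l _ (hE np1)) => //.
  rewrite le_eqVlt; apply/orP; left; apply/eqP.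
  have -> : 2 * ((1 - 2 / n%:R) * (p * #|cube_edges n|%:R)) =
     (1 - 2 / n%:R) * p * (2 * #|cube_edges n|%:R) :> R by ring.
  by rewrite card_cube_edgesR; ring.
rewrite ler_pM2r ?exprn_gt0 // -ME.
have : n%:R^-1 * M <= v * M by rewrite ler_wpM2r // ltW.
clear ub em w8 nv np1 ME Dnp wM w9 sM dM Mm m0 sl wn w1 p1.
lra.
Qed.

End Regimes.

(** * Failure probabilities *)

Lemma predU_negP (T : Type) (A B : pred T) x :
  ~~ predU A B x -> ~~ A x /\ ~~ B x.
Proof. by rewrite /= negb_or => /andP. Qed.

Section Probability.
Variables (R : realType) (n : nat) (p w c : R).
Hypothesis p01 : 0 <= p <= 1.
Hypothesis w_large : 96 ^+ 3 <= w.
Hypothesis w_root : w ^+ 20 = n%:R.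
Let Om := cube_edges n.

Let w1024 : 1024 <= w.
Proof. by apply: le_trans w_large; lra. Qed.

Let pk k : 0 < w ^+ k. Proof. by rewrite exprn_gt0 //; move: w1024; lra. Qed.

Let wle j k : (j <= k)%N -> w ^+ j <= w ^+ k.
Proof. by move=> jk; rewrite ler_eXn2l //; move: w1024; lra. Qed.

Let nw : w <= n%:R.
Proof. by rewrite -w_root -[leLHS]expr1; exact: wle. Qed.

Let n1024 : 1024 <= n%:R :> R. Proof. exact: le_trans nw. Qed.

Let n_gt0 : (0 < n)%N.
Proof. by rewrite -(ltr0n R); move: n1024; lra. Qed.

Let n0 : 0 < n%:R :> R. Proof. by rewrite ltr0n. Qed.

Let n_big : 1024 * w <= n%:R.
Proof.
rewrite -w_root; apply: le_trans (wle (isT : (2 <= 20)%N)).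
rewrite expr2 ler_wpM2r ?w1024 //; move: w1024; lra.
Qed.

Let pow2_cube : 2 * n%:R ^+ 3 <= 2 ^+ n :> R.
Proof.
apply: le_trans (pow2_ge_expR R n).
apply: le_trans (@expR_ge_pow R (n%:R / 2) 3 _); last by rewrite divr_ge0.
set y : R := n%:R / 2 / 4%:R; have -> : n%:R = 8 * y by rewrite /y; field.
have y1 : 1024 <= y by rewrite /y; move: n_big w1024; lra.
have -> : 2 * (8 * y) ^+ 3 = 1024 * y ^+ 3 by ring.
by rewrite (exprS y 3) ler_wpM2r // exprn_ge0 //; lra.
Qed.

Let not_close : pred {set {set cube n}} := fun E => ~~ lambda1_close p E c.

Let linear_le_expR (x y : R) : n%:R / 6 <= x -> y = expR x / 2 -> n%:R <= y.
Proof.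
move=> hx ->; have x0 : 0 <= x by move: n0 hx; lra.
have := @expR_ge_pow R x 1 x0; set z : R := x / 2%:R.
have nz : n%:R <= 12 * z by rewrite /z; lra.
have z1 : 24 <= z by move: n1024; lra.
have : 24 * z <= z ^+ 2 by rewrite expr2 ler_wpM2r //; lra.
lra.
Qed.

(* Here [w = n^(1/20)], so that all the parameters are powers of [w]; the
   maximum degree exceeds [n^(9/10)] with high probability. *)
Lemma prob_not_close_dense : 241 <= c -> (n%:R ^+ 2)^-1 <= p ->
  prob Om p not_close <= 4 * expR (1 - n%:R).
Proof.
move=> c1 np2; case/andP: (p01) => p0 p1.
have w0 : 0 < w by move: w1024; lra.
pose v := w^-1; have v0 : 0 < v by rewrite invr_gt0.
have vw : v * w = 1 by rewrite mulVf // gt_eqF.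
have vS k : v * w ^+ k.+1 = w ^+ k by rewrite exprS mulrA vw mul1r.
have v1 : v <= 1 by rewrite invf_le1 //; move: w1024; lra.
pose mu := Num.max (n%:R * p) (w ^+ 9); pose t := (1 + v) * mu.
pose X := 128 * w ^+ 22.
pose k := (Num.trunc (w ^+ 18)).+1.
have kw : w ^+ 18 <= k%:R by apply/ltW/truncnS_gt.
have kw2 : k%:R <= 2 * w ^+ 18.
  have h : (Num.trunc (w ^+ 18))%:R <= w ^+ 18 by rewrite truncn_le ltW.
  have h1 : 1 <= w ^+ 18 by rewrite -[leLHS](expr0 w); exact: wle.
  have -> : k%:R = (Num.trunc (w ^+ 18))%:R + 1 :> R by rewrite natr1.
  lra.
have kn : (k <= n)%N.
  rewrite -(ler_nat R) -w_root; apply: le_trans kw2 _.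
  apply: le_trans (wle (isT : (19 <= 20)%N)).
  by rewrite (exprS w 18) ler_wpM2r ?(ltW (pk _)) //; move: w1024; lra.
pose B1 := high_cluster t X (n := n).
pose B2 := fun E : {set {set cube n}} => (max_degree E < k)%N.
pose B3 := fun E : {set {set cube n}} => (1 <= n%:R * p) &&
  (#|E|%:R < (1 - 2 / n%:R) * (p * #|Om|%:R)).
have h1 : prob Om p B1 <= 2 * expR (1 - n%:R).
  apply: (@prob_high_cluster R n p p01 t X (v ^+ 2 / 64) (v / 8)) => //.
  - by rewrite divr_ge0 ?sqr_ge0.
  - by rewrite divr_ge0 // ltW.
  - have -> : v ^+ 2 / 64 * X = 2 * (v * (v * w ^+ 22)) by rewrite /X; field.
    by rewrite !vS w_root.
  - set s := _ + v / 8.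
    have vv : v ^+ 2 <= v by rewrite expr2 ler_piMr // ltW.
    have sb : 0 <= s <= 9 / 64 * v.
      rewrite /s addr_ge0 ?divr_ge0 ?sqr_ge0 ?(ltW v0) //=; lra.
    have es : expR s - 1 <= v / 8 + v ^+ 2 / 16.
      case/andP: sb => s0 sv.
      have s2 : s ^+ 2 <= (9 / 64 * v) ^+ 2 by rewrite lerXn2r ?nnegrE //; lra.
      have e2 : expR s <= 1 + s + 2 * s ^+ 2.
        by apply: expR_le_quadratic; apply/andP; split; lra.
      have sE : s = v ^+ 2 / 64 + v / 8 by [].
      by move: s2 e2 (sqr_ge0 v); rewrite exprMn; lra.
    have w9mu : w ^+ 9 <= mu by rewrite le_max lexx orbT.
    have dmu : n%:R * p <= mu by rewrite le_max lexx.
    have mu0 : 0 <= mu by apply: le_trans w9mu; exact: ltW.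
    have expo : n%:R * (p * (expR s - 1)) - v / 8 * t <= - (w ^+ 7 / 16).
      have a1 : n%:R * p * (expR s - 1) <= mu * (v / 8 + v ^+ 2 / 16).
        apply: le_trans (ler_wpM2l _ es) _; first by rewrite mulr_ge0.
        by rewrite ler_wpM2r // addr_ge0 ?divr_ge0 ?sqr_ge0 // ltW.
      have a2 : v ^+ 2 * w ^+ 9 <= v ^+ 2 * mu by rewrite ler_wpM2l ?sqr_ge0.
      have a3 : v ^+ 2 * w ^+ 9 = w ^+ 7 by rewrite expr2 -mulrA !vS.
      have -> : v / 8 * t = mu * (v / 8 + v ^+ 2 / 8) by rewrite /t; field.
      lra.
    apply: (@le_trans _ _ (n%:R ^+ 2 * expR (- (w ^+ 7 / 16)))).
      by rewrite ler_wpM2l ?exprn_ge0 // ler_expR.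
    rewrite expRN ler_pdivrMr ?expR_gt0 // mul1r.
    apply: le_trans (@expR_ge_pow R (w ^+ 7 / 16) 5 _); last by rewrite divr_ge0 // ltW.
    have -> : w ^+ 7 / 16 / 6%:R = w ^+ 7 / 96 by field.
    rewrite -w_root expr_div_n ler_pdivlMr ?exprn_gt0 //.
    have -> : (w ^+ 7) ^+ 6 = (w ^+ 20) ^+ 2 * w ^+ 2 by ring.
    rewrite ler_wpM2l ?sqr_ge0 // (_ : 96 ^+ 6 = (96 ^+ 3) ^+ 2); last by rewrite -exprM.
    by apply: lerXn2r; rewrite ?nnegrE ?exprn_ge0 // ltW.
have h2 : prob Om p B2 <= expR (1 - n%:R).
  apply: prob_small_max_degree => //.
  have pe : expR (- (40 * w)) <= p.
    apply: le_trans np2; rewrite -w_root -exprM expRN lef_pV2 ?posrE ?expR_gt0 //.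
    rewrite expRM_natl; apply: lerXn2r; rewrite ?nnegrE ?expR_ge0 ?(ltW w0) //.
    by apply: le_trans (expR_ge1Dx _); rewrite lerDr.
  apply: le_trans (_ : expR (- (80 * w ^+ 19)) * (expR (n%:R / 2) / 2) <= _).
    apply: (@linear_le_expR (- (80 * w ^+ 19) + n%:R / 2)); last by rewrite mulrA expRD.
    have : 1024 * w ^+ 19 <= n%:R by rewrite -w_root (exprS w 19) ler_wpM2r // ltW.
    by have := pk 19; lra.
  apply: ler_pM; rewrite ?divr_ge0 ?expR_ge0 //; last first.
    by rewrite ler_wpM2r // pow2_ge_expR.
  apply: (@le_trans _ _ (expR (- (40 * w)) ^+ k)); last first.
    by apply: lerXn2r; rewrite ?nnegrE ?expR_ge0.
  rewrite -expRM_natr ler_expR mulNr lerN2 -mulrA.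
  have : w * k%:R <= w * (2 * w ^+ 18) by rewrite ler_wpM2l // ltW.
  by rewrite (exprS w 18); lra.
have h3 : prob Om p B3 <= expR (1 - n%:R).
  have [np1|np1] := boolP (1 <= n%:R * p).
    apply: le_trans (prob_few_edges_dense p01 np1 pow2_cube).
    by apply: le_prob => // E _ /andP[].
  rewrite /prob big1 ?expR_ge0 // => E /andP[_].
  by rewrite /B3 (negbTE np1).
apply: (@le_trans _ _ (prob Om p (predU B1 (predU B2 B3)))).
  apply: le_prob => // E EO; apply: contraNT.
  move=> h; have [nB1 h'] := predU_negP h; have [nB2 nB3] := predU_negP h'.
  apply: (@lambda1_close_dense R n p E EO c w) => //.
  - by move: w1024; lra.
  - by apply: le_trans kw _; rewrite ler_nat leqNgt.
  - by move=> np1; move: nB3; rewrite /B3 np1 /= -leNgt.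
apply: le_trans (prob_predU _ p01 _ _) _.
have := prob_predU Om p01 B2 B3; lra.
Qed.

(* Up to constants the maximum degree is [X = 8 n / ln (1/q)]. Replacing [p] by
   [q >= 2^-n] covers the case [p = 0]. *)
Lemma prob_not_close_sparse : 64 ^+ 2 <= c -> p <= (n%:R ^+ 2)^-1 ->
  prob Om p not_close <= 4 * expR (1 - n%:R).
Proof.
move=> c1 np2; case/andP: (p01) => p0 p1.
have en0 : 0 < expR (1 - n%:R) :> R by exact: expR_gt0.
have n2 : 0 < n%:R ^+ 2 :> R by rewrite exprn_gt0.
have np1 : n%:R * p <= 1.
  apply: le_trans (ler_wpM2l (ltW n0) np2) _.
  rewrite ler_pdivrMr // mul1r expr2 ler_peMl ?(ltW n0) //; move: n1024; lra.
pose q := Num.max p (2 ^+ n)^-1.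
have q0 : 0 < q by rewrite lt_max invr_gt0 exprn_gt0 ?orbT.
have pq : p <= q by rewrite le_max lexx.
have qn : q <= (n%:R ^+ 2)^-1.
  rewrite ge_max np2 /= lef_pV2 ?posrE ?exprn_gt0 //; apply: le_trans pow2_cube.
  rewrite (exprS _ 2) mulrA ler_peMl ?(ltW n2) //; move: n1024; lra.
have nq : n%:R ^+ 2 * q <= 1.
  by have := ler_wpM2l (ltW n2) qn; rewrite divff // gt_eqF.
have [l0 ql0] := expR_total q0; pose l := - l0.
have ql : expR (- l) = q by rewrite opprK.
have l_big : 1 / 3 <= l.
  rewrite leNgt; apply/negP => l3.
  have : q <= 4^-1.
    apply: le_trans qn _; rewrite lef_pV2 ?posrE //; apply: le_trans (_ : 2 * 2 <= _).
      lra.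
    by rewrite expr2; apply: ler_pM; rewrite //; move: n1024; lra.
  by rewrite -ql; have := @expR_ge1Dx R (- l); lra.
have lpos : 0 < l by lra.
pose X := 8 * n%:R / l.
have X0 : 0 <= X by rewrite divr_ge0 ?mulr_ge0 // ltW.
have lX : l * X = 8 * n%:R by rewrite /X mulrC divfK // gt_eqF.
pose B1 := high_cluster 8 X (n := n).
have h1 : prob Om p B1 <= 2 * expR (1 - n%:R).
  apply: (@prob_high_cluster R n p p01 8 X (l / 4) (l / 4)) => //.
  - by rewrite divr_ge0 // ltW.
  - by rewrite divr_ge0 // ltW.
  - by rewrite mulrAC lX; lra.
  - have -> : l / 4 + l / 4 = l / 2 by field.
    set r := expR (- (l / 2)).
    have r0 : 0 < r := expR_gt0 _.
    have rq : r ^+ 2 = q by rewrite -ql -expRM_natr; congr expR; field.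
    have rn : n%:R * r <= 1.
      rewrite -(@ler_pXn2r _ 2%N) ?nnegrE ?mulr_ge0 ?(ltW n0) ?(ltW r0) //.
      by rewrite exprMn rq expr1n.
    have le1 : n%:R * (p * (expR (l / 2) - 1)) - l / 4 * 8 <= 1 - 2 * l.
      have -> : l / 4 * 8 = 2 * l by field.
      suff : n%:R * (p * (expR (l / 2) - 1)) <= 1 by lra.
      apply: le_trans rn; rewrite ler_wpM2l ?(ltW n0) //.
      have e1 : expR (l / 2) - 1 <= r^-1 by rewrite /r expRN invrK; lra.
      have -> : r = q * r^-1 by rewrite -rq expr2 mulfK // gt_eqF.
      apply: le_trans (ler_wpM2l p0 e1) _.
      by rewrite ler_wpM2r // invr_ge0 ltW.
    apply: (@le_trans _ _ (n%:R ^+ 2 * expR (1 - 2 * l))).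
      by rewrite ler_wpM2l ?(ltW n2) // ler_expR.
    have -> : expR (1 - 2 * l) = expR 1 * q ^+ 2.
      by rewrite expRD -ql -expRM_natr; congr (_ * expR _); ring.
    have e4 : expR 1 <= 4 :> R.
      have -> : expR 1 = expR (2^-1) ^+ 2 :> R by rewrite -expRM_natr; congr expR; field.
      have h2 := expR_half_le2 R; have h0 := expR_ge0 (2^-1 : R).
      by rewrite expr2; have := ler_pM h0 h0 h2 h2; lra.
    have q4 : 4 * q <= 1.
      apply: le_trans nq; rewrite ler_wpM2r ?(ltW q0) //.
      apply: le_trans (_ : 2 * 2 <= _); first lra.
      by rewrite expr2; apply: ler_pM; rewrite //; move: n1024; lra.
    have -> : n%:R ^+ 2 * (expR 1 * q ^+ 2) = (n%:R ^+ 2 * q) * (expR 1 * q) by ring.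
    rewrite -[leRHS]mulr1; apply: ler_pM => //.
    - by rewrite mulr_ge0 ?(ltW n2) // ltW.
    - by rewrite mulr_ge0 ?expR_ge0 // ltW.
    - by apply: le_trans q4; rewrite ler_wpM2r // ltW.
have c64 : 511 <= c by apply: le_trans c1; lra.
have [XK|XK] := leP X (64 ^+ 2).
  apply: (@le_trans _ _ (prob Om p B1)); last first.
    by apply: (le_trans h1); rewrite ler_wpM2r ?(ltW en0) //; lra.
  apply: le_prob => // E EO; apply: contraNT => nB1.
  have := degree_le_of_no_cluster n_gt0 X0 nB1.
  move=> D; apply: (@lambda1_close_bounded R n p E p0 EO c 64) => //; first lra.
  by apply: le_trans D _; rewrite ge_max XK andbT; lra.
have qp : q = p.
  have [lt2|le2] := ltP p (2 ^+ n)^-1; last by apply/max_idPl.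
  exfalso; have qE : q = (2 ^+ n)^-1 by apply/max_idPr; exact: ltW lt2.
  have : n%:R / 2 <= l.
    rewrite -lerN2 -ler_expR ql qE expRN lef_pV2 ?posrE ?expR_gt0 ?exprn_gt0 //.
    exact: pow2_ge_expR.
  move=> /(ler_wpM2r X0); rewrite lX; have : n%:R * 64 ^+ 2 < n%:R * X by rewrite ltr_pM2l.
  by move: n0; lra.
pose k := Num.trunc (X / 24).
have kX : k%:R <= X / 24 by rewrite truncn_le divr_ge0.
have Xk : X / 24 < k.+1%:R := truncnS_gt _.
have X3 : X <= 24 * n%:R.
  by have := ler_wpM2r X0 l_big; rewrite lX; lra.
have kn : (k <= n)%N by rewrite -(ler_nat R); lra.
pose B2 := fun E : {set {set cube n}} => (max_degree E < k)%N.
have h2 : prob Om p B2 <= expR (1 - n%:R).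
  apply: prob_small_max_degree => //.
  apply: (@le_trans _ _ (expR (- (n%:R / 3)) * (expR (n%:R / 2) / 2))).
    apply: (@linear_le_expR (- (n%:R / 3) + n%:R / 2)); last by rewrite mulrA expRD.
    by lra.
  apply: ler_pM; rewrite ?divr_ge0 ?expR_ge0 //; last first.
    by rewrite ler_wpM2r // pow2_ge_expR.
  rewrite -qp -ql -expRM_natr ler_expR mulNr lerN2.
  by have := ler_wpM2l (ltW lpos) kX; rewrite mulrA lX; lra.
apply: (@le_trans _ _ (prob Om p (predU B1 B2))); last first.
  by apply: le_trans (prob_predU _ p01 _ _) _; lra.
apply: le_prob => // E EO; apply: contraNT => h; have [nB1 nB2] := predU_negP h.
pose b := X `^ 8%:R^-1.
have b0 : 0 <= b := powR_ge0 _ _.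
have b8 : b ^+ 8 = X by rewrite -powR_mulrn // -powRrM mulVf ?powRr1 // pnatr_eq0.
have bb : 8 <= b ^+ 2.
  rewrite leNgt; apply/negP => lt8; move: XK; rewrite -b8 ltNge => /negP; apply.
  have -> : b ^+ 8 = (b ^+ 2 * b ^+ 2) ^+ 2 by ring.
  have b20 : 0 <= b ^+ 2 := sqr_ge0 _.
  have := ler_pM b20 b20 (ltW lt8) (ltW lt8) => b64.
  apply: lerXn2r; rewrite ?nnegrE ?mulr_ge0 //; lra.
have b2 : 2 <= b.
  rewrite leNgt; apply/negP => lt2; have := ler_pM b0 b0 (ltW lt2) (ltW lt2).
  by rewrite -expr2; lra.
have kD : k%:R <= (max_degree E)%:R :> R by rewrite ler_nat leqNgt.
have XD : X <= 48 * (max_degree E)%:R.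
  have kS : k.+1%:R = k%:R + 1 :> R by rewrite natr1.
  by move: Xk kD XK; rewrite kS; lra.
have DX := degree_le_of_no_cluster n_gt0 X0 nB1.
apply: (@lambda1_close_sparse R n p E EO c b) => //.
- by rewrite ler1n -(ltr0n R); lra.
- by rewrite b8; apply: le_trans DX _; rewrite ge_max lexx andbT; lra.
- by rewrite b8.
- by rewrite b8; apply: contra nB1; exact: high_clusterW.
Qed.

Lemma prob_not_close : 64 ^+ 2 <= c ->
  prob Om p not_close <= 4 * expR (1 - n%:R).
Proof.
move=> c1; have [np|np] := leP (n%:R ^+ 2)^-1 p.
  by apply: prob_not_close_dense => //; apply: le_trans c1; lra.
by apply: prob_not_close_sparse => //; exact: ltW.
Qed.

End Probability.

Local Open Scope classical_set_scope.

Lemma error_rate_cvg0 (R : realType) (c : R) : 0 <= c ->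
  error_rate c x @[x --> +oo] --> (0 : R).
Proof.
move=> c0; apply/cvgrPdist_le => e e0.
pose y := (c + 1) / e; have y0 : 0 < y by rewrite divr_gt0 //; lra.
near=> x.
have xy : y ^+ 20 <= x by near: x; apply: nbhs_pinfty_ge; exact: num_real.
have x0 : 0 < x by apply: lt_le_trans xy; rewrite exprn_gt0.
have rooty : y <= x `^ 20^-1.
  have {1}-> : y = (y ^+ 20) `^ 20^-1.
    by rewrite -powR_mulrn ?(ltW y0) // -powRrM divff ?powRr1 ?(ltW y0).
  by apply: ge0_ler_powR; rewrite ?nnegrE ?invr_ge0 ?ler0n // ?ltW // exprn_gt0.
rewrite sub0r normrN ger0_norm ?divr_ge0 ?powR_ge0 //.
rewrite ler_pdivrMr ?powR_gt0 //; apply: le_trans (ler_wpM2l (ltW e0) rooty).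
by rewrite /y mulrC divfK ?gt_eqF //; lra.
Unshelve. all: by end_near. Qed.

Theorem theorem1p1 (R : realType) :
  exists delta : R -> R,
    [/\ forall x : R, 0 <= x -> 0 <= delta x,
        delta x @[x --> +oo] --> (0 : R)
      & forall p : nat -> R, (forall n : nat, 0 <= p n <= 1) ->
          (fun n : nat =>
             prob_cube (p n) (fun E : {set {set cube n}} =>
               let M := Num.max (Num.sqrt (max_degree E)%:R) (n%:R * p n) in
               `|lambda1 R E - M| <= delta M * M))
          @ \oo --> (1 : R)].
Proof.
have c0 : 0 <= 64 ^+ 2 :> R by exact: sqr_ge0.
exists (error_rate (64 ^+ 2)); split.
- by move=> x _; rewrite divr_ge0 // powR_ge0.
- exact: error_rate_cvg0.
move=> p p01; apply/cvgrPdist_le => e e0; near=> n.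
pose w : R := n%:R `^ 20^-1.
have wn : w ^+ 20 = n%:R.
  by rewrite -powR_mulrn ?powR_ge0 // -powRrM mulVf ?powRr1.
have w_large : 96 ^+ 3 <= w.
  have large : (96 ^+ 3) ^+ 20 <= n%:R :> R by near: n; exact: nbhs_infty_ger.
  rewrite leNgt; apply/negP => lt; move: large; rewrite -wn leNgt => /negP; apply.
  by apply: ltrXn2r => //; exact: powR_ge0.
have ne : 4 / e <= n%:R by near: n; exact: nbhs_infty_ger.
have n0 : 0 < n%:R :> R by apply: lt_le_trans ne; rewrite divr_gt0.
have := @prob_not_close R n (p n) w _ (p01 n) w_large wn (lexx (64 ^+ 2)).
move=> h; change (`|1 - prob (cube_edges n) (p n)
  (fun E => lambda1_close (p n) E (64 ^+ 2))| <= e); rewrite prob_predC.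
rewrite opprB addrCA subrr addr0 ger0_norm ?prob_ge0 //.
apply: (le_trans h); have hn : n%:R <= expR (n%:R - 1) :> R.
  by apply: le_trans (expR_ge1Dx _); rewrite subrKC.
rewrite -opprB expRN ler_pdivrMr ?expR_gt0 //.
apply: (@le_trans _ _ (e * n%:R)); last by rewrite ler_wpM2l // ltW.
by rewrite mulrC -ler_pdivrMr.
Unshelve. all: by end_near. Qed.
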